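(* Let $Y$ be a reflexive asymptotically uniformly smooth Banach space, and assume that a Banach space $X$ coarse Lipschitz embeds into $Y$. Then $X$ has the Banach-Saks property.
   Context: All Banach spaces are real and infinite dimensional. For a map $f:(M,d)\to(N,\partial)$ between metric spaces, $\omega_f(t)=\sup\{\partial(f(x),f(y)) : d(x,y)\le t\}$ and $\rho_f(t)=\inf\{\partial(f(x),f(y)) : d(x,y)\ge t\}$. $f$ is a coarse Lipschitz embedding if there is $L>0$ with $\omega_f(t)\le Lt+L$ and $\rho_f(t)\ge L^{-1}t-L$ for all $t\ge 0$. The modulus of asymptotic uniform smoothness of a Banach space $Y$ is $\overline{\rho}_Y(t)=\sup_{x\in\partial B_Y}\inf_{\dim(Y/E)<\infty}\sup_{h\in\partial B_E}\|x+th\|-1$, where $E$ ranges over closed finite-codimensional subspaces and $\partial B$ denotes the unit sphere; $Y$ is asymptotically uniformly smooth if $\lim_{t\to0^+}\overline{\rho}_Y(t)/t=0$. A Banach space $X$ has the Banach-Saks property if every bounded sequence $(x_n)$ in $X$ has a subsequence $(x_{n_j})$ such that $(\frac1k\sum_{j=1}^k x_{n_j})_{k}$ converges in norm. *)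

(* Defs.v *)
From Stdlib Require Import Reals Lra List Classical ClassicalEpsilon.
Open Scope R_scope.

(** Supremum of a set of reals: the least upper bound when it exists
    (always the case for the nonempty bounded sets we apply it to). *)
Definition Rsup (P : R -> Prop) : R :=
  epsilon (inhabits 0) (fun l => is_lub P l).
Definition Rinf (P : R -> Prop) : R := - Rsup (fun r => P (- r)).

Record Banach := {
  carrier :> Type;
  vzero : carrier;
  vadd : carrier -> carrier -> carrier;
  vopp : carrier -> carrier;
  vscal : R -> carrier -> carrier;
  vnorm : carrier -> R;
  vadd_assoc : forall x y z, vadd x (vadd y z) = vadd (vadd x y) z;
  vadd_comm : forall x y, vadd x y = vadd y x;
  vadd_0 : forall x, vadd vzero x = x;
  vadd_opp : forall x, vadd x (vopp x) = vzero;
  vscal_addr : forall a x y, vscal a (vadd x y) = vadd (vscal a x) (vscal a y);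
  vscal_addl : forall a b x, vscal (a + b) x = vadd (vscal a x) (vscal b x);
  vscal_assoc : forall a b x, vscal a (vscal b x) = vscal (a * b) x;
  vscal_1 : forall x, vscal 1 x = x;
  vnorm_eq0 : forall x, vnorm x = 0 -> x = vzero;
  vnorm_scal : forall a x, vnorm (vscal a x) = Rabs a * vnorm x;
  vnorm_triangle : forall x y, vnorm (vadd x y) <= vnorm x + vnorm y;
  vcomplete : forall u : nat -> carrier,
      (forall eps, eps > 0 -> exists N, forall m n, (m >= N)%nat -> (n >= N)%nat ->
          vnorm (vadd (u m) (vopp (u n))) < eps) ->
      exists l, forall eps, eps > 0 -> exists N, forall n, (n >= N)%nat ->
          vnorm (vadd (u n) (vopp l)) < eps;
  vinfinite_dim : forall l : list carrier, exists x,
      forall c : list (R * carrier), (forall p, In p c -> In (snd p) l) ->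
        x <> fold_right (fun p acc => vadd (vscal (fst p) (snd p)) acc) vzero c
}.

Arguments vzero {_}.
Arguments vadd {_}.
Arguments vopp {_}.
Arguments vscal {_}.
Arguments vnorm {_}.

Definition vsub {X : Banach} (x y : X) : X := vadd x (vopp y).

Definition lincomb {X : Banach} (c : list (R * X)) : X :=
  fold_right (fun p acc => vadd (vscal (fst p) (snd p)) acc) vzero c.

Definition converges_to {X : Banach} (u : nat -> X) (l : X) : Prop :=
  forall eps, eps > 0 -> exists N, forall n, (n >= N)%nat -> vnorm (vsub (u n) l) < eps.

Definition closed_subspace {Y : Banach} (E : Y -> Prop) : Prop :=
  E vzero /\
  (forall x y, E x -> E y -> E (vadd x y)) /\
  (forall a x, E x -> E (vscal a x)) /\
  (forall (u : nat -> Y) l, (forall n, E (u n)) -> converges_to u l -> E l).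

Definition finite_codim {Y : Banach} (E : Y -> Prop) : Prop :=
  exists vs : list Y, forall y, exists e (c : list (R * Y)),
    E e /\ (forall p, In p c -> In (snd p) vs) /\ y = vadd e (lincomb c).

Definition mod_AUS (Y : Banach) (t : R) : R :=
  Rsup (fun r => exists x : Y, vnorm x = 1 /\
    r = Rinf (fun s => exists E : Y -> Prop, closed_subspace E /\ finite_codim E /\
          s = Rsup (fun u => exists h : Y, E h /\ vnorm h = 1 /\
                 u = vnorm (vadd x (vscal t h)) - 1))).

Definition AUS (Y : Banach) : Prop :=
  forall eps, eps > 0 -> exists delta, delta > 0 /\
    forall t, 0 < t < delta -> Rabs (mod_AUS Y t / t) < eps.

Definition bounded_linear_functional {X : Banach} (f : X -> R) : Prop :=
  (forall x y, f (vadd x y) = f x + f y) /\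
  (forall a x, f (vscal a x) = a * f x) /\
  (exists C, forall x, Rabs (f x) <= C * vnorm x).

Definition dual (X : Banach) := { f : X -> R | bounded_linear_functional f }.

Definition dual_norm {X : Banach} (f : dual X) : R :=
  Rsup (fun r => exists x : X, vnorm x <= 1 /\ r = Rabs (proj1_sig f x)).

Definition reflexive (X : Banach) : Prop :=
  forall Phi : dual X -> R,
    (forall f g : dual X, forall h : dual X,
        (forall x, proj1_sig h x = proj1_sig f x + proj1_sig g x) ->
        Phi h = Phi f + Phi g) ->
    (forall a (f h : dual X),
        (forall x, proj1_sig h x = a * proj1_sig f x) -> Phi h = a * Phi f) ->
    (exists C, forall f, Rabs (Phi f) <= C * dual_norm f) ->
    exists x : X, forall f : dual X, Phi f = proj1_sig f x.

(** Coarse Lipschitz embedding: omega_f(t) <= L t + L and rho_f(t) >= t/L - L. *)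
Definition coarse_lipschitz_embedding {X Y : Banach} (f : X -> Y) : Prop :=
  exists L, L > 0 /\
    (forall t, t >= 0 -> forall x y, vnorm (vsub x y) <= t ->
        vnorm (vsub (f x) (f y)) <= L * t + L) /\
    (forall t, t >= 0 -> forall x y, vnorm (vsub x y) >= t ->
        vnorm (vsub (f x) (f y)) >= t / L - L).

Definition coarse_lipschitz_embeds (X Y : Banach) : Prop :=
  exists f : X -> Y, coarse_lipschitz_embedding f.

Fixpoint vsum {X : Banach} (g : nat -> X) (k : nat) : X :=
  match k with
  | O => vzero
  | S k' => vadd (vsum g k') (g k')
  end.

Definition banach_saks (X : Banach) : Prop :=
  forall x : nat -> X, (exists M, forall n, vnorm (x n) <= M) ->
    exists phi : nat -> nat, (forall j, (phi j < phi (S j))%nat) /\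
      exists z : X, converges_to
        (fun k => vscal (/ INR (S k)) (vsum (fun j => x (phi j)) (S k))) z.

(* Main.v *)
Require Import Defs.
From Stdlib Require Import Reals Lra Lia List Classical ClassicalEpsilon.
From Stdlib Require Import FunctionalExtensionality ProofIrrelevance.
From mathcomp Require classical_sets filter.
Open Scope R_scope.

(** Fix a nonprincipal ultrafilter U on the integers. If F is a map from
    k-tuples of integers to Y that moves by at most 1 when one coordinate
    changes, reflexivity provides the iterated weak limits F_j(n_1, ..., n_j)
    of F in the variables n_k, ..., n_(j+1), and F - F_0 is a sum of k increments
    F_j - F_(j-1) of norm at most 1, each weakly null along U in n_j. Weakly null
    vectors are nearly contained in any closed finite-codimensional subspace, so
    asymptotic uniform smoothness says that such an increment adds at most eps to
    the norm of a long vector. Hence |F - F_0| <= O(1) + eps k for U-almost all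
    n_1, ..., U-almost all n_k.

    Applied to (n_1, ..., n_k) |-> f (lam (x_(n_1) + ... + x_(n_k))), with f the
    embedding and lam large, this shows that all sums of k-blocks of a suitable
    subsequence of a bounded sequence (x_n) differ by at most eps k. Diagonalising
    over eps makes the Cesaro means of the subsequence Cauchy. *)

(** * Vector algebra and a decision procedure for linear identities *)

Lemma vadd_0_r {X : Banach} (x : X) : vadd x vzero = x.
Proof. rewrite vadd_comm. apply vadd_0. Qed.

Lemma vadd_cancel_l {X : Banach} (x y z : X) : vadd x y = vadd x z -> y = z.
Proof.
  intros H.
  rewrite <- (vadd_0 _ y), <- (vadd_0 _ z), <- (vadd_opp _ x), (vadd_comm _ x).
  rewrite <- !vadd_assoc, H. reflexivity.
Qed.

Lemma vscal_0_l {X : Banach} (x : X) : vscal 0 x = vzero.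
Proof.
  apply (vadd_cancel_l (vscal 0 x)).
  rewrite <- vscal_addl, vadd_0_r. f_equal; lra.
Qed.

Lemma vscal_0_r {X : Banach} (a : R) : vscal a (@vzero X) = vzero.
Proof.
  apply (vadd_cancel_l (vscal a vzero)).
  rewrite <- vscal_addr, !vadd_0_r. reflexivity.
Qed.

Lemma vopp_scal {X : Banach} (x : X) : vopp x = vscal (-1) x.
Proof.
  apply (vadd_cancel_l x). rewrite vadd_opp.
  rewrite <- (vscal_1 _ x) at 1. rewrite <- vscal_addl.
  replace (1 + -1) with 0 by lra. symmetry. apply vscal_0_l.
Qed.

Lemma vadd_swap {X : Banach} (a b c d : X) :
  vadd (vadd a b) (vadd c d) = vadd (vadd a c) (vadd b d).
Proof.
  rewrite <- !vadd_assoc. f_equal. rewrite !vadd_assoc. f_equal. apply vadd_comm.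
Qed.

(** Syntax for proof by reflection: a linear identity between vectors reduces to equality of the
    real coefficients of each atom. *)
Inductive vexp :=
| VVar (n : nat)
| VZero
| VAdd (a b : vexp)
| VOpp (a : vexp)
| VScal (r : R) (a : vexp).

Fixpoint veval {X : Banach} (env : list X) (e : vexp) : X :=
  match e with
  | VVar n => nth n env vzero
  | VZero => vzero
  | VAdd a b => vadd (veval env a) (veval env b)
  | VOpp a => vopp (veval env a)
  | VScal r a => vscal r (veval env a)
  end.

Fixpoint vcoef (e : vexp) (i : nat) : R :=
  match e with
  | VVar n => if Nat.eqb i n then 1 else 0
  | VZero => 0
  | VAdd a b => vcoef a i + vcoef b i
  | VOpp a => - vcoef a i
  | VScal r a => r * vcoef a i
  end.

Fixpoint vlin {X : Banach} (env : list X) (c : nat -> R) : X :=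
  match env with
  | nil => vzero
  | x :: env' => vadd (vscal (c O) x) (vlin env' (fun i => c (S i)))
  end.

(** Recursion on the environment makes this compute to a finite conjunction of equations between
    reals, which [ring] and [field] can settle. *)
Fixpoint same_coefs {A : Type} (env : list A) (c d : nat -> R) : Prop :=
  match env with
  | nil => True
  | _ :: env' => c O = d O /\ same_coefs env' (fun i => c (S i)) (fun i => d (S i))
  end.

Lemma vlin_zero {X : Banach} (env : list X) : vlin env (fun _ => 0) = vzero.
Proof.
  induction env as [|x env IH]; simpl; [reflexivity|].
  rewrite IH, vscal_0_l. apply vadd_0.
Qed.

Lemma vlin_add {X : Banach} (env : list X) : forall c d,
  vlin env (fun i => c i + d i) = vadd (vlin env c) (vlin env d).
Proof.
  induction env as [|x env IH]; intros c d; simpl.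
  - symmetry; apply vadd_0.
  - rewrite (IH (fun i => c (S i)) (fun i => d (S i))), vscal_addl. apply vadd_swap.
Qed.

Lemma vlin_scal {X : Banach} (env : list X) : forall a c,
  vlin env (fun i => a * c i) = vscal a (vlin env c).
Proof.
  induction env as [|x env IH]; intros a c; simpl.
  - symmetry; apply vscal_0_r.
  - rewrite (IH a (fun i => c (S i))), vscal_addr, vscal_assoc. reflexivity.
Qed.

Lemma vlin_var {X : Banach} (env : list X) : forall n,
  vlin env (fun i => if Nat.eqb i n then 1 else 0) = nth n env vzero.
Proof.
  induction env as [|x env IH]; intros [|n]; simpl; try reflexivity.
  - rewrite vlin_zero, vscal_1. apply vadd_0_r.
  - rewrite IH, vscal_0_l. apply vadd_0.
Qed.

Lemma veval_vlin {X : Banach} (env : list X) (e : vexp) :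
  veval env e = vlin env (vcoef e).
Proof.
  induction e as [n| |a IHa b IHb|a IHa|r a IHa]; simpl.
  - symmetry. apply vlin_var.
  - symmetry. apply vlin_zero.
  - rewrite IHa, IHb. symmetry. apply (vlin_add env (vcoef a) (vcoef b)).
  - rewrite IHa, vopp_scal, <- vlin_scal. f_equal.
    apply functional_extensionality. intros i. ring.
  - rewrite IHa. symmetry. apply (vlin_scal env r (vcoef a)).
Qed.

Lemma same_coefs_vlin {X : Banach} (env : list X) : forall c d,
  same_coefs env c d -> vlin env c = vlin env d.
Proof.
  induction env as [|x env IH]; simpl; intros c d H; [reflexivity|].
  destruct H as [H0 H]. rewrite H0. f_equal. apply IH, H.
Qed.

Lemma veval_eq {X : Banach} (env : list X) (a b : vexp) :
  same_coefs env (vcoef a) (vcoef b) -> veval env a = veval env b.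
Proof. intros H. rewrite !veval_vlin. apply same_coefs_vlin, H. Qed.

Ltac venv_add x env :=
  match env with
  | context [cons x _] => env
  | _ => constr:(cons x env)
  end.

Ltac venv_of e env :=
  lazymatch e with
  | vzero => env
  | vadd ?a ?b => let env' := venv_of a env in venv_of b env'
  | vopp ?a => venv_of a env
  | vscal ?r ?a => venv_of a env
  | ?x => venv_add x env
  end.

Ltac vindex x env :=
  lazymatch env with
  | cons x _ => constr:(O)
  | cons _ ?env' => let n := vindex x env' in constr:(S n)
  end.

Ltac vreify e env :=
  lazymatch e with
  | vzero => constr:(VZero)
  | vadd ?a ?b => let a' := vreify a env in let b' := vreify b env in constr:(VAdd a' b')
  | vopp ?a => let a' := vreify a env in constr:(VOpp a')
  | vscal ?r ?a => let a' := vreify a env in constr:(VScal r a')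
  | ?x => let n := vindex x env in constr:(VVar n)
  end.

Ltac vlinear :=
  unfold vsub in *;
  lazymatch goal with
  | |- @eq (carrier ?X) ?a ?b =>
    let env := venv_of a (@nil (carrier X)) in
    let env := venv_of b env in
    let a' := vreify a env in
    let b' := vreify b env in
    change (veval env a' = veval env b');
    apply veval_eq; cbn [same_coefs vcoef Nat.eqb];
    (* Coefficients may contain inverses; [lra] derives the nonvanishing of denominators from the
       context. *)
    repeat split; try ring; try (field; lra)
  end.

(** * Elementary norm estimates *)

Lemma vnorm_zero {X : Banach} : vnorm (@vzero X) = 0.
Proof. rewrite <- (vscal_0_l vzero), vnorm_scal, Rabs_R0. ring. Qed.

Lemma vnorm_opp {X : Banach} (x : X) : vnorm (vopp x) = vnorm x.
Proof. rewrite vopp_scal, vnorm_scal, Rabs_left by lra. ring. Qed.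

Lemma vnorm_ge0 {X : Banach} (x : X) : 0 <= vnorm x.
Proof.
  pose proof (vnorm_triangle _ x (vopp x)) as H.
  rewrite vadd_opp, vnorm_zero, vnorm_opp in H. lra.
Qed.

Lemma vnorm_sub_sym {X : Banach} (x y : X) : vnorm (vsub x y) = vnorm (vsub y x).
Proof. rewrite <- vnorm_opp. f_equal. vlinear. Qed.

Lemma vnorm_sub_le {X : Banach} (x y : X) : vnorm (vsub x y) <= vnorm x + vnorm y.
Proof. rewrite <- (vnorm_opp y). apply vnorm_triangle. Qed.

Lemma vnorm_sub_triangle {X : Banach} (x y z : X) :
  vnorm (vsub x z) <= vnorm (vsub x y) + vnorm (vsub y z).
Proof.
  replace (vsub x z) with (vadd (vsub x y) (vsub y z)) by vlinear.
  apply vnorm_triangle.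
Qed.

Lemma vnorm_unit {X : Banach} (x : X) : 0 < vnorm x -> vnorm (vscal (/ vnorm x) x) = 1.
Proof.
  intros H. rewrite vnorm_scal, Rabs_pos_eq.
  - field. lra.
  - apply Rlt_le, Rinv_0_lt_compat, H.
Qed.

Lemma vnorm_pos {X : Banach} (x : X) : x <> vzero -> 0 < vnorm x.
Proof.
  intros H. destruct (vnorm_ge0 x) as [H0|H0]; [exact H0|].
  exfalso. apply H, vnorm_eq0. auto.
Qed.

(** * Suprema, infima and Zorn's lemma *)

(** [Rsup] is picked by [epsilon], so it is known to be a supremum only once the set is shown
    nonempty and bounded above; every later use passes through these two conditions. *)
Lemma Rsup_lub (P : R -> Prop) (b : R) :
  (exists x, P x) -> (forall x, P x -> x <= b) -> is_lub P (Rsup P).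
Proof.
  intros Hne Hb. unfold Rsup. apply epsilon_spec.
  destruct (completeness P) as [l Hl]; [exists b; exact Hb|exact Hne|].
  exists l. exact Hl.
Qed.

Lemma Rinf_le (P : R -> Prop) (b x : R) : (forall y, P y -> b <= y) -> P x -> Rinf P <= x.
Proof.
  intros Hb Hx.
  destruct (Rsup_lub (fun r => P (- r)) (- b)) as [Hub _].
  - exists (- x). rewrite Ropp_involutive. exact Hx.
  - intros y Hy. apply Hb in Hy. lra.
  - unfold Rinf. specialize (Hub (- x)). cbv beta in Hub.
    rewrite Ropp_involutive in Hub. specialize (Hub Hx). lra.
Qed.

Lemma Rinf_ge (P : R -> Prop) (b : R) :
  (exists x, P x) -> (forall y, P y -> b <= y) -> b <= Rinf P.
Proof.
  intros [x Hx] Hb.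
  destruct (Rsup_lub (fun r => P (- r)) (- b)) as [_ Hleast].
  - exists (- x). rewrite Ropp_involutive. exact Hx.
  - intros y Hy. apply Hb in Hy. lra.
  - unfold Rinf. assert (H : Rsup (fun r => P (- r)) <= - b).
    { apply Hleast. intros y Hy. apply Hb in Hy. lra. }
    lra.
Qed.

Lemma Rinf_lt_witness (P : R -> Prop) (b c : R) :
  (exists x, P x) -> (forall y, P y -> b <= y) -> Rinf P < c -> exists x, P x /\ x < c.
Proof.
  intros Hne Hb Hc. apply NNPP. intros Hno.
  assert (H : c <= Rinf P).
  { apply Rinf_ge; [exact Hne|]. intros y Hy.
    destruct (Rlt_le_dec y c) as [Hlt|Hle]; [|exact Hle].
    exfalso. apply Hno. exists y. auto. }
  lra.
Qed.

Lemma zorn_lemma (T : Type) (le : T -> T -> Prop) :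
  (forall t, le t t) ->
  (forall r s t, le r s -> le s t -> le r t) ->
  (forall s t, le s t -> le t s -> s = t) ->
  (forall A : T -> Prop, (forall s t, A s -> A t -> le s t \/ le t s) ->
     exists t, forall s, A s -> le s t) ->
  exists t, forall s, le t s -> s = t.
Proof.
  intros Hrefl Htrans Hanti Hchain.
  (* The imported form of Zorn's lemma takes a boolean relation; excluded middle converts the order
     into one. *)
  pose (leb := fun s t => if excluded_middle_informative (le s t) then true else false).
  assert (Hleb : forall s t, leb s t = true <-> le s t).
  { intros s t. unfold leb. destruct (excluded_middle_informative (le s t)); split; auto; discriminate. }
  destruct (@classical_sets.Zorn T leb) as [t Ht].
  - intros t. apply Hleb, Hrefl.
  - intros r s t H1 H2. apply Hleb. apply Htrans with s; apply Hleb; assumption.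
  - intros s t H1 H2. apply Hanti; apply Hleb; assumption.
  - intros A HA. destruct (Hchain A) as [t Ht].
    + intros s t Hs Ht. destruct (HA s t Hs Ht) as [H|H]; apply Hleb in H; auto.
    + exists t. intros s Hs. apply Hleb, Ht, Hs.
  - exists t. intros s Hs. apply Ht, Hleb, Hs.
Qed.

(** * Norming functionals *)

(** Positive homogeneity is asked only as an inequality; applying it to both [t] and [/ t] recovers
    equality in [sublinear_scal]. *)
Definition sublinear {X : Banach} (p : X -> R) : Prop :=
  (forall x y, p (vadd x y) <= p x + p y) /\
  (forall t x, 0 <= t -> p (vscal t x) <= t * p x).

Lemma sublinear_zero {X : Banach} (p : X -> R) : sublinear p -> p vzero = 0.
Proof.
  intros [Ha Hs]. specialize (Ha vzero vzero). rewrite vadd_0 in Ha.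
  specialize (Hs 0 vzero (Rle_refl 0)). rewrite vscal_0_l in Hs. lra.
Qed.

Lemma sublinear_scal {X : Banach} (p : X -> R) (t : R) (x : X) :
  sublinear p -> 0 <= t -> p (vscal t x) = t * p x.
Proof.
  intros Hp [Ht|Ht].
  - apply Rle_antisym; [apply Hp; lra|].
    assert (H : p (vscal (/ t) (vscal t x)) <= / t * p (vscal t x)).
    { apply Hp. apply Rlt_le, Rinv_0_lt_compat, Ht. }
    rewrite vscal_assoc, Rinv_l, vscal_1 in H by lra.
    apply (Rmult_le_compat_l t) in H; [|lra].
    rewrite <- Rmult_assoc, Rinv_r in H by lra. lra.
  - subst t. rewrite vscal_0_l, sublinear_zero by exact Hp. ring.
Qed.

Lemma sublinear_lower {X : Banach} (p : X -> R) (x : X) : sublinear p -> - p (vopp x) <= p x.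
Proof.
  intros Hp. pose proof (proj1 Hp x (vopp x)) as H.
  rewrite vadd_opp, sublinear_zero in H by exact Hp. lra.
Qed.

Lemma vnorm_sublinear (X : Banach) : sublinear (@vnorm X).
Proof.
  split; [apply vnorm_triangle|]. intros t x Ht.
  rewrite vnorm_scal, Rabs_pos_eq by exact Ht. lra.
Qed.

(* The largest sublinear functional below [p] that sends [- y] to [- p y]. *)
Definition odd_at {X : Banach} (p : X -> R) (y x : X) : R :=
  Rinf (fun r => exists t, 0 <= t /\ r = p (vadd x (vscal t y)) - t * p y).

Lemma odd_at_bounded {X : Banach} (p : X -> R) (y x : X) : sublinear p ->
  forall r, (exists t, 0 <= t /\ r = p (vadd x (vscal t y)) - t * p y) -> - p (vopp x) <= r.
Proof.
  intros Hp r [t [Ht ->]].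
  pose proof (proj1 Hp (vadd x (vscal t y)) (vopp x)) as H.
  replace (vadd (vadd x (vscal t y)) (vopp x)) with (vscal t y) in H by vlinear.
  rewrite sublinear_scal in H by assumption. lra.
Qed.

Lemma odd_at_le {X : Banach} (p : X -> R) (y x : X) (t : R) : sublinear p -> 0 <= t ->
  odd_at p y x <= p (vadd x (vscal t y)) - t * p y.
Proof.
  intros Hp Ht. apply Rinf_le with (- p (vopp x)).
  - apply odd_at_bounded, Hp.
  - exists t. auto.
Qed.

Lemma odd_at_ge {X : Banach} (p : X -> R) (y x : X) (b : R) : sublinear p ->
  (forall t, 0 <= t -> b <= p (vadd x (vscal t y)) - t * p y) -> b <= odd_at p y x.
Proof.
  intros Hp H. apply Rinf_ge.
  - exists (p (vadd x (vscal 0 y)) - 0 * p y), 0. split; [lra|reflexivity].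
  - intros r [t [Ht ->]]. apply H, Ht.
Qed.

Lemma odd_at_below {X : Banach} (p : X -> R) (y x : X) : sublinear p -> odd_at p y x <= p x.
Proof.
  intros Hp. pose proof (odd_at_le p y x 0 Hp (Rle_refl 0)) as H.
  rewrite vscal_0_l, vadd_0_r in H. lra.
Qed.

Lemma odd_at_opp {X : Banach} (p : X -> R) (y : X) : sublinear p ->
  odd_at p y (vopp y) <= - p y.
Proof.
  intros Hp. pose proof (odd_at_le p y (vopp y) 1 Hp ltac:(lra)) as H.
  replace (vadd (vopp y) (vscal 1 y)) with (@vzero X) in H by vlinear.
  rewrite sublinear_zero in H by exact Hp. lra.
Qed.

(** For subadditivity, parameters [t] for [x] and [s] for [z] give the competitor [t + s] for the
    sum. For homogeneity, the parameter is rescaled along with the vector. *)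
Lemma odd_at_sublinear {X : Banach} (p : X -> R) (y : X) : sublinear p -> sublinear (odd_at p y).
Proof.
  intros Hp. split.
  - intros x z.
    assert (H : forall t, 0 <= t -> odd_at p y (vadd x z) - (p (vadd x (vscal t y)) - t * p y) <= odd_at p y z).
    { intros t Ht. apply odd_at_ge; [exact Hp|]. intros s Hs.
      pose proof (odd_at_le p y (vadd x z) (t + s) Hp ltac:(lra)) as H1.
      pose proof (proj1 Hp (vadd x (vscal t y)) (vadd z (vscal s y))) as H2.
      replace (vadd (vadd x (vscal t y)) (vadd z (vscal s y)))
        with (vadd (vadd x z) (vscal (t + s) y)) in H2 by vlinear.
      lra. }
    assert (H' : odd_at p y (vadd x z) - odd_at p y z <= odd_at p y x).
    { apply odd_at_ge; [exact Hp|]. intros t Ht. specialize (H t Ht). lra. }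
    lra.
  - intros s x [Hs|Hs].
    + assert (H : / s * odd_at p y (vscal s x) <= odd_at p y x).
      { apply odd_at_ge; [exact Hp|]. intros t Ht.
        pose proof (odd_at_le p y (vscal s x) (s * t) Hp ltac:(nra)) as H.
        replace (vadd (vscal s x) (vscal (s * t) y))
          with (vscal s (vadd x (vscal t y))) in H by vlinear.
        rewrite (sublinear_scal p) in H by (assumption || lra).
        apply (Rmult_le_compat_l (/ s)) in H; [|apply Rlt_le, Rinv_0_lt_compat, Hs].
        replace (/ s * (s * p (vadd x (vscal t y)) - s * t * p y))
          with (p (vadd x (vscal t y)) - t * p y) in H by (field; lra).
        exact H. }
      apply (Rmult_le_compat_l s) in H; [|lra].
      rewrite <- Rmult_assoc, Rinv_r in H by lra. lra.
    + subst s. rewrite vscal_0_l. pose proof (odd_at_below p y vzero Hp) as H.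
      rewrite (sublinear_zero p) in H by exact Hp. lra.
Qed.

(** Zorn's lemma for the reversed pointwise order. The bound of a chain is its pointwise infimum,
    which is finite because a sublinear [p] below [q] satisfies [p x >= - q (vopp x)]. *)
Lemma minimal_sublinear {X : Banach} (q : X -> R) : sublinear q ->
  exists p, sublinear p /\ (forall x, p x <= q x) /\
    forall p', sublinear p' -> (forall x, p' x <= p x) -> p' = p.
Proof.
  intros Hq.
  pose (T := {p : X -> R | sublinear p /\ forall x, p x <= q x}).
  pose (le := fun a b : T => forall x, proj1_sig b x <= proj1_sig a x).
  assert (Hext : forall a b : T, proj1_sig a = proj1_sig b -> a = b).
  { intros [a Ha] [b Hb]. simpl. intros ->. f_equal. apply proof_irrelevance. }
  destruct (zorn_lemma T le) as [[p [Hp Hpq]] Hmax].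
  - intros t x. apply Rle_refl.
  - intros r s t H1 H2 x. apply Rle_trans with (proj1_sig s x); [apply H2|apply H1].
  - intros s t H1 H2. apply Hext. apply functional_extensionality. intros x.
    apply Rle_antisym; [apply H2|apply H1].
  (* The empty chain is bounded by [q] itself. *)
  - intros A HA. destruct (classic (exists a, A a)) as [[a0 Ha0]|Hno].
    2: { exists (exist _ q (conj Hq (fun x => Rle_refl (q x)))).
         intros s Hs. exfalso. apply Hno. exists s. exact Hs. }
    pose (P := fun x r => exists a : T, A a /\ r = proj1_sig a x).
    assert (Hlow : forall x r, P x r -> - q (vopp x) <= r).
    { intros x r [[a [Ha Haq]] [_ ->]]. simpl.
      pose proof (sublinear_lower a x Ha). specialize (Haq (vopp x)). lra. }
    pose (m := fun x => Rinf (P x)).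
    assert (Hle : forall a x, A a -> m x <= proj1_sig a x).
    { intros a x Ha. apply Rinf_le with (- q (vopp x)); [apply Hlow|].
      exists a. auto. }
    assert (Hge : forall x b, (forall a, A a -> b <= proj1_sig a x) -> b <= m x).
    { intros x b Hb. apply Rinf_ge.
      - exists (proj1_sig a0 x), a0. auto.
      - intros r [a [Ha ->]]. apply Hb, Ha. }
    assert (Hm : sublinear m).
    { split.
      - intros x y.
        assert (H : forall a, A a -> m (vadd x y) - proj1_sig a x <= m y).
        { intros a Ha. apply Hge. intros b Hb.
          (* Two members of the chain are comparable, so subadditivity of the smaller one serves for
             both. *)
          destruct (HA a b Ha Hb) as [Hab|Hab].
          - pose proof (proj1 (proj1 (proj2_sig b)) x y).
            specialize (Hab x). pose proof (Hle b (vadd x y) Hb). lra.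
          - pose proof (proj1 (proj1 (proj2_sig a)) x y).
            specialize (Hab y). pose proof (Hle a (vadd x y) Ha). lra. }
        assert (H' : m (vadd x y) - m y <= m x).
        { apply Hge. intros a Ha. specialize (H a Ha). lra. }
        lra.
      - intros t x [Ht|Ht].
        + assert (H : / t * m (vscal t x) <= m x).
          { apply Hge. intros a Ha. pose proof (Hle a (vscal t x) Ha) as H.
            rewrite (sublinear_scal (proj1_sig a)) in H by (apply (proj2_sig a) || lra).
            apply (Rmult_le_compat_l (/ t)) in H; [|apply Rlt_le, Rinv_0_lt_compat, Ht].
            rewrite <- Rmult_assoc, Rinv_l in H by lra. lra. }
          apply (Rmult_le_compat_l t) in H; [|lra].
          rewrite <- Rmult_assoc, Rinv_r in H by lra. lra.
        + subst t. rewrite vscal_0_l. pose proof (Hle a0 vzero Ha0) as H.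
          rewrite (sublinear_zero (proj1_sig a0)) in H by apply (proj2_sig a0). lra. }
    assert (Hmq : forall x, m x <= q x).
    { intros x. apply Rle_trans with (proj1_sig a0 x); [apply Hle, Ha0|apply (proj2_sig a0)]. }
    exists (exist _ m (conj Hm Hmq)). intros s Hs x. apply Hle, Hs.
  - exists p. split; [exact Hp|]. split; [exact Hpq|]. intros p' Hp' Hp'p.
    assert (Hp'q : forall x, p' x <= q x).
    { intros x. apply Rle_trans with (p x); auto. }
    specialize (Hmax (exist _ p' (conj Hp' Hp'q)) Hp'p).
    apply (f_equal (@proj1_sig _ _)) in Hmax. exact Hmax.
Qed.

(** [odd_at p y] is sublinear and lies below [p], so minimality makes them equal and [p] is odd. An
    odd sublinear functional is linear. *)
Lemma minimal_sublinear_linear {X : Banach} (p : X -> R) : sublinear p ->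
  (forall p', sublinear p' -> (forall x, p' x <= p x) -> p' = p) ->
  (forall x y, p (vadd x y) = p x + p y) /\ (forall a x, p (vscal a x) = a * p x).
Proof.
  intros Hp Hmin.
  assert (Hodd : forall y, p (vopp y) = - p y).
  { intros y. pose proof (sublinear_lower p y Hp).
    assert (He : odd_at p y = p).
    { apply Hmin; [apply odd_at_sublinear, Hp|]. intros x. apply odd_at_below, Hp. }
    pose proof (odd_at_opp p y Hp) as H1. rewrite He in H1. lra. }
  split.
  - intros x y. apply Rle_antisym; [apply Hp|].
    pose proof (proj1 Hp (vopp x) (vopp y)) as H.
    replace (vadd (vopp x) (vopp y)) with (vopp (vadd x y)) in H by vlinear.
    rewrite !Hodd in H. lra.
  - intros a x. destruct (Rle_lt_dec 0 a) as [Ha|Ha].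
    + apply sublinear_scal; assumption.
    + replace (vscal a x) with (vopp (vscal (- a) x)) by vlinear.
      rewrite Hodd, sublinear_scal by (assumption || lra). ring.
Qed.

(** This is the Hahn-Banach consequence needed below. Minimising below [odd_at vnorm y] rather than
    below the norm forces the value at [vopp y] to be at most [- vnorm y], hence the value at [y] to
    be [vnorm y]. *)
Lemma norming_functional {X : Banach} (y : X) :
  exists f : dual X, proj1_sig f y = vnorm y /\ forall x, Rabs (proj1_sig f x) <= vnorm x.
Proof.
  pose proof (vnorm_sublinear X) as Hn.
  destruct (minimal_sublinear (odd_at vnorm y)) as [p [Hp [Hpq Hmin]]].
  { apply odd_at_sublinear, Hn. }
  destruct (minimal_sublinear_linear p Hp Hmin) as [Hadd Hscal].
  assert (Hle : forall x, p x <= vnorm x).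
  { intros x. apply Rle_trans with (odd_at vnorm y x); [apply Hpq|apply odd_at_below, Hn]. }
  assert (Hopp : forall x, p (vopp x) = - p x).
  { intros x. rewrite vopp_scal, Hscal. ring. }
  assert (Habs : forall x, Rabs (p x) <= vnorm x).
  { intros x. apply Rabs_le. split; [|apply Hle].
    pose proof (Hle (vopp x)) as H. rewrite vnorm_opp, Hopp in H. lra. }
  assert (Hf : bounded_linear_functional p).
  { split; [exact Hadd|]. split; [exact Hscal|]. exists 1. intros x. rewrite Rmult_1_l. apply Habs. }
  exists (exist _ p Hf). split; [|exact Habs]. simpl.
  apply Rle_antisym; [apply Hle|].
  pose proof (Hpq (vopp y)) as H. pose proof (odd_at_opp vnorm y Hn). rewrite Hopp in H. lra.
Qed.

(** * Limits along an ultrafilter *)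

Record nonprincipal_ultrafilter (U : (nat -> Prop) -> Prop) : Prop := {
  uf_mono : forall A B : nat -> Prop, (forall n, A n -> B n) -> U A -> U B;
  uf_and : forall A B : nat -> Prop, U A -> U B -> U (fun n => A n /\ B n);
  uf_or_not : forall A : nat -> Prop, U A \/ U (fun n => ~ A n);
  uf_proper : ~ U (fun _ => False);
  uf_gt : forall N, U (fun n => (N < n)%nat)
}.

(** Any ultrafilter that extends the filter of cofinite sets will do; containing all tails is what
    makes it nonprincipal. *)
Lemma nonprincipal_ultrafilter_exists : exists U, nonprincipal_ultrafilter U.
Proof.
  pose (F := fun A : nat -> Prop => exists N, forall n, (N < n)%nat -> A n).
  assert (HF : filter.ProperFilter F).
  { split.
    - intros [N HN]. apply (HN (S N)). lia.
    - split.
      + exists O. intros n _. exact I.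
      + intros A B [N HN] [M HM]. exists (max N M). intros n Hn. split.
        * apply HN. lia.
        * apply HM. lia.
      + intros A B HAB [N HN]. exists N. intros n Hn. apply HAB, HN, Hn. }
  destruct (filter.ultraFilterLemma HF) as [U [HU HFU]].
  pose proof (filter.ultra_proper (UltraFilter := HU)) as HP.
  pose proof (filter.filter_filter (ProperFilter := HP)) as HFil.
  exists U. split.
  - intros A B HAB HA. exact (filter.filterS (Filter := HFil) HAB HA).
  - intros A B HA HB. exact (filter.filterI (Filter := HFil) HA HB).
  - intros A. exact (filter.in_ultra_setVsetC A HU).
  - intros H. exact (filter.filter_not_empty U (ProperFilter := HP) H).
  - intros N. apply HFU. exists N. auto.
Qed.

Lemma uf_witness U (A : nat -> Prop) : nonprincipal_ultrafilter U -> U A -> exists n, A n.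
Proof.
  intros HU HA. apply NNPP. intros Hno. apply (uf_proper U HU).
  apply (uf_mono U HU A); [|exact HA]. intros n Hn. apply Hno. exists n. exact Hn.
Qed.

Lemma uf_all U (A : nat -> Prop) : nonprincipal_ultrafilter U -> (forall n, A n) -> U A.
Proof.
  intros HU HA. apply (uf_mono U HU (fun n => (0 < n)%nat)); [auto|apply uf_gt, HU].
Qed.

Lemma uf_forall_below U (A : nat -> nat -> Prop) (N : nat) : nonprincipal_ultrafilter U ->
  (forall i, (i < N)%nat -> U (A i)) -> U (fun n => forall i, (i < N)%nat -> A i n).
Proof.
  intros HU. induction N as [|N IH]; intros H.
  - apply uf_all; [exact HU|]. intros n i Hi. lia.
  - apply (uf_mono U HU (fun n => (forall i, (i < N)%nat -> A i n) /\ A N n)).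
    + intros n [H1 H2] i Hi. destruct (Nat.eq_dec i N) as [->|Hne]; [exact H2|].
      apply H1. lia.
    + apply uf_and; [exact HU| |apply H; lia]. apply IH. intros i Hi. apply H. lia.
Qed.

Lemma uf_impl U (P : Prop) (A : nat -> Prop) : nonprincipal_ultrafilter U ->
  (P -> U A) -> U (fun n => P -> A n).
Proof.
  intros HU H. destruct (classic P) as [HP|HP].
  - apply (uf_mono U HU A); auto.
  - apply uf_all; [exact HU|]. intros n HP'. contradiction.
Qed.

Lemma Rabs_le_inv (x a : R) : Rabs x <= a -> - a <= x <= a.
Proof.
  intros H. pose proof (Rle_abs x). pose proof (Rle_abs (- x)) as H'.
  rewrite Rabs_Ropp in H'. lra.
Qed.

Definition ulim (U : (nat -> Prop) -> Prop) (a : nat -> R) (l : R) : Prop :=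
  forall eps, eps > 0 -> U (fun n => Rabs (a n - l) < eps).

(** The limit is the supremum of the reals [r] with [r <= a n] for almost all [n]; the ultrafilter
    dichotomy gives the matching upper estimate. *)
Lemma ulim_exists U (a : nat -> R) (C : R) : nonprincipal_ultrafilter U ->
  (forall n, Rabs (a n) <= C) -> exists l, ulim U a l.
Proof.
  intros HU Ha.
  assert (Hb : forall n, - C <= a n <= C).
  { intros n. apply Rabs_le_inv, Ha. }
  destruct (completeness (fun r => U (fun n => r <= a n))) as [l [Hub Hleast]].
  - exists C. intros r Hr. destruct (uf_witness U _ HU Hr) as [n Hn]. specialize (Hb n). lra.
  - exists (- C). apply uf_all; [exact HU|]. intros n. apply Hb.
  - exists l. intros eps Heps.
    assert (H1 : U (fun n => a n < l + eps)).
    { destruct (uf_or_not U HU (fun n => l + eps <= a n)) as [H|H].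
      - apply Hub in H. lra.
      - apply (uf_mono U HU _ _ (fun n Hn => Rnot_le_lt _ _ Hn) H). }
    assert (H2 : exists r, U (fun n => r <= a n) /\ l - eps < r).
    { apply NNPP. intros Hno. assert (l <= l - eps); [|lra].
      apply Hleast. intros r Hr. apply Rnot_lt_le. intros Hlt. apply Hno. exists r. auto. }
    destruct H2 as [r [Hr Hlr]].
    apply (uf_mono U HU (fun n => a n < l + eps /\ r <= a n)).
    + intros n [H3 H4]. apply Rabs_def1; lra.
    + apply uf_and; assumption.
Qed.

Lemma ulim_ext U (a b : nat -> R) (l : R) : (forall n, a n = b n) -> ulim U a l -> ulim U b l.
Proof.
  intros H Ha. replace b with a; [exact Ha|]. apply functional_extensionality, H.
Qed.

Lemma ulim_const U (l : R) : nonprincipal_ultrafilter U -> ulim U (fun _ => l) l.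
Proof.
  intros HU eps Heps. apply uf_all; [exact HU|]. intros _.
  unfold Rminus. rewrite Rplus_opp_r, Rabs_R0. exact Heps.
Qed.

Lemma ulim_add U (a b : nat -> R) (l m : R) : nonprincipal_ultrafilter U ->
  ulim U a l -> ulim U b m -> ulim U (fun n => a n + b n) (l + m).
Proof.
  intros HU Ha Hb eps Heps.
  apply (uf_mono U HU (fun n => Rabs (a n - l) < eps / 2 /\ Rabs (b n - m) < eps / 2)).
  - intros n [H1 H2]. apply Rabs_def2 in H1, H2. apply Rabs_def1; lra.
  - apply uf_and; [exact HU|apply Ha; lra|apply Hb; lra].
Qed.

Lemma ulim_scal U (c : R) (a : nat -> R) (l : R) : nonprincipal_ultrafilter U ->
  ulim U a l -> ulim U (fun n => c * a n) (c * l).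
Proof.
  intros HU Ha eps Heps.
  assert (Hc : 0 < Rabs c + 1) by (pose proof (Rabs_pos c); lra).
  apply (uf_mono U HU (fun n => Rabs (a n - l) < eps / (Rabs c + 1))).
  - intros n H. rewrite <- Rmult_minus_distr_l, Rabs_mult.
    pose proof (Rabs_pos c). pose proof (Rabs_pos (a n - l)).
    apply Rle_lt_trans with ((Rabs c + 1) * Rabs (a n - l)); [nra|].
    apply (Rmult_lt_compat_l (Rabs c + 1)) in H; [|exact Hc].
    replace ((Rabs c + 1) * (eps / (Rabs c + 1))) with eps in H by (field; lra). exact H.
  - apply Ha. apply Rdiv_lt_0_compat; lra.
Qed.

Lemma ulim_le U (a : nat -> R) (l C : R) : nonprincipal_ultrafilter U ->
  ulim U a l -> (forall n, a n <= C) -> l <= C.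
Proof.
  intros HU Ha HC. apply Rnot_lt_le. intros Hlt.
  destruct (uf_witness U _ HU (Ha (l - C) ltac:(lra))) as [n Hn].
  apply Rabs_def2 in Hn. specialize (HC n). lra.
Qed.

Lemma ulim_unique U (a : nat -> R) (l m : R) : nonprincipal_ultrafilter U ->
  ulim U a l -> ulim U a m -> l = m.
Proof.
  intros HU Hl Hm.
  assert (Hd : ulim U (fun _ => 0) (l + (-1) * m)).
  { apply ulim_ext with (fun n => a n + (-1) * a n); [intros n; ring|].
    apply ulim_add; [exact HU|exact Hl|]. apply ulim_scal; assumption. }
  apply NNPP. intros Hne.
  assert (Hpos : Rabs (l + (-1) * m) > 0) by (apply Rabs_pos_lt; lra).
  destruct (uf_witness U _ HU (Hd _ Hpos)) as [n Hn].
  rewrite Rminus_0_l, Rabs_Ropp in Hn. lra.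
Qed.

(** * Weak limits *)

Definition wlimit {Y : Banach} (U : (nat -> Prop) -> Prop) (u : nat -> Y) (y : Y) : Prop :=
  forall f : dual Y, ulim U (fun n => proj1_sig f (u n)) (proj1_sig f y).

Lemma dual_add {Y : Banach} (f : dual Y) (x y : Y) :
  proj1_sig f (vadd x y) = proj1_sig f x + proj1_sig f y.
Proof. apply (proj2_sig f). Qed.

Lemma dual_scal {Y : Banach} (f : dual Y) (a : R) (x : Y) :
  proj1_sig f (vscal a x) = a * proj1_sig f x.
Proof. apply (proj2_sig f). Qed.

Lemma dual_zero {Y : Banach} (f : dual Y) : proj1_sig f vzero = 0.
Proof. rewrite <- (vscal_0_l vzero), dual_scal. ring. Qed.

Lemma dual_sub {Y : Banach} (f : dual Y) (x y : Y) :
  proj1_sig f (vsub x y) = proj1_sig f x + (-1) * proj1_sig f y.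
Proof. unfold vsub. rewrite vopp_scal, dual_add, dual_scal. reflexivity. Qed.

Lemma dual_norm_bound {Y : Banach} (f : dual Y) (x : Y) :
  Rabs (proj1_sig f x) <= dual_norm f * vnorm x.
Proof.
  destruct (proj2 (proj2 (proj2_sig f))) as [C HC].
  destruct (Rsup_lub (fun r => exists x : Y, vnorm x <= 1 /\ r = Rabs (proj1_sig f x))
              (Rabs C)) as [Hub _].
  - exists (Rabs (proj1_sig f vzero)), vzero. rewrite vnorm_zero. split; [lra|reflexivity].
  - intros r [y [Hy ->]]. apply Rle_trans with (C * vnorm y); [apply HC|].
    pose proof (Rle_abs C). pose proof (Rabs_pos C). pose proof (vnorm_ge0 y). nra.
  - destruct (classic (x = vzero)) as [->|Hx].
    + rewrite dual_zero, vnorm_zero, Rabs_R0. lra.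
    + apply vnorm_pos in Hx.
      assert (H : Rabs (proj1_sig f (vscal (/ vnorm x) x)) <= dual_norm f).
      { apply Hub. exists (vscal (/ vnorm x) x). rewrite vnorm_unit by exact Hx.
        split; [lra|reflexivity]. }
      rewrite dual_scal, Rabs_mult, (Rabs_pos_eq (/ vnorm x)) in H
        by (apply Rlt_le, Rinv_0_lt_compat, Hx).
      apply (Rmult_le_compat_l (vnorm x)) in H; [|lra].
      rewrite <- Rmult_assoc, Rinv_r in H by lra. lra.
Qed.

Lemma dual_norm_ge0 {Y : Banach} (f : dual Y) : 0 <= dual_norm f.
Proof.
  (* At the empty list, infinite dimension provides a nonzero vector, on which the bound by the dual
     norm is tested. *)
  destruct (vinfinite_dim Y nil) as [x Hx].
  assert (Hp : 0 < vnorm x).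
  { apply vnorm_pos. apply (Hx nil). intros p []. }
  pose proof (dual_norm_bound f x). pose proof (Rabs_pos (proj1_sig f x)). nra.
Qed.

(** Sending [f] to the limit of [f (u n)] along [U] is a bounded linear functional on the dual;
    reflexivity represents it by a vector, the weak limit. *)
Lemma wlimit_exists {Y : Banach} U (u : nat -> Y) (C : R) : nonprincipal_ultrafilter U ->
  reflexive Y -> (forall n, vnorm (u n) <= C) -> exists y, wlimit U u y.
Proof.
  intros HU HY Hu.
  assert (Hb : forall (f : dual Y) n, Rabs (proj1_sig f (u n)) <= C * dual_norm f).
  { intros f n. apply Rle_trans with (dual_norm f * vnorm (u n)); [apply dual_norm_bound|].
    pose proof (dual_norm_ge0 f). specialize (Hu n). nra. }
  pose (Phi := fun f : dual Y =>
    epsilon (inhabits 0) (fun l => ulim U (fun n => proj1_sig f (u n)) l)).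
  assert (HPhi : forall f, ulim U (fun n => proj1_sig f (u n)) (Phi f)).
  { intros f. apply (epsilon_spec (inhabits 0) (fun l => ulim U (fun n => proj1_sig f (u n)) l)).
    apply ulim_exists with (C * dual_norm f); [exact HU|apply Hb]. }
  destruct (HY Phi) as [y Hy].
  - intros f g h Hh. apply (ulim_unique U (fun n => proj1_sig h (u n))); [exact HU|apply HPhi|].
    apply ulim_ext with (fun n => proj1_sig f (u n) + proj1_sig g (u n)).
    + intros n. symmetry. apply Hh.
    + apply ulim_add; auto.
  - intros a f h Hh. apply (ulim_unique U (fun n => proj1_sig h (u n))); [exact HU|apply HPhi|].
    apply ulim_ext with (fun n => a * proj1_sig f (u n)).
    + intros n. symmetry. apply Hh.
    + apply ulim_scal; auto.
  - exists C. intros f. apply Rabs_le.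
    assert (H1 : Phi f <= C * dual_norm f).
    { apply (ulim_le U (fun n => proj1_sig f (u n))); auto.
      intros n. apply Rle_trans with (Rabs (proj1_sig f (u n))); [apply Rle_abs|apply Hb]. }
    assert (H2 : (-1) * Phi f <= C * dual_norm f).
    { apply (ulim_le U (fun n => (-1) * proj1_sig f (u n))); auto.
      - apply ulim_scal; auto.
      - intros n. specialize (Hb f n). apply Rabs_le_inv in Hb. lra. }
    lra.
  - exists y. intros f. rewrite <- Hy. apply HPhi.
Qed.

Lemma wlimit_const {Y : Banach} U (y : Y) : nonprincipal_ultrafilter U -> wlimit U (fun _ => y) y.
Proof. intros HU f. apply ulim_const, HU. Qed.

Lemma wlimit_sub {Y : Banach} U (u v : nat -> Y) (y z : Y) : nonprincipal_ultrafilter U ->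
  wlimit U u y -> wlimit U v z -> wlimit U (fun n => vsub (u n) (v n)) (vsub y z).
Proof.
  intros HU Hu Hv f. rewrite dual_sub.
  apply ulim_ext with (fun n => proj1_sig f (u n) + (-1) * proj1_sig f (v n)).
  - intros n. symmetry. apply dual_sub.
  - apply ulim_add; [exact HU|apply Hu|]. apply ulim_scal; [exact HU|apply Hv].
Qed.

(** Weak lower semicontinuity of the norm, tested on a functional that norms [vsub y z]. *)
Lemma wlimit_dist {Y : Banach} U (u v : nat -> Y) (y z : Y) (C : R) :
  nonprincipal_ultrafilter U -> wlimit U u y -> wlimit U v z ->
  (forall n, vnorm (vsub (u n) (v n)) <= C) -> vnorm (vsub y z) <= C.
Proof.
  intros HU Hu Hv HC.
  destruct (norming_functional (vsub y z)) as [f [Hf Hfb]].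
  rewrite <- Hf.
  apply (ulim_le U (fun n => proj1_sig f (vsub (u n) (v n)))); [exact HU| |].
  - apply wlimit_sub; assumption.
  - intros n. apply Rle_trans with (Rabs (proj1_sig f (vsub (u n) (v n)))); [apply Rle_abs|].
    apply Rle_trans with (vnorm (vsub (u n) (v n))); [apply Hfb|apply HC].
Qed.

(** * Closed subspaces of finite codimension *)

Definition add_line {Y : Banach} (E : Y -> Prop) (v y : Y) : Prop :=
  exists e c, E e /\ y = vadd e (vscal c v).

Lemma closed_subspace_sub {Y : Banach} (E : Y -> Prop) (x y : Y) :
  closed_subspace E -> E x -> E y -> E (vsub x y).
Proof.
  intros [_ [Ha [Hs _]]] Hx Hy. unfold vsub. rewrite vopp_scal. auto.
Qed.

(** [v] has positive distance to the closed set [E], and scaling gives the estimate. It makes the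
    coefficient of [v] in E + Rv unique and continuous. *)
Lemma closed_subspace_distance {Y : Banach} (E : Y -> Prop) (v : Y) :
  closed_subspace E -> ~ E v ->
  exists delta, 0 < delta /\ forall e c, E e -> delta * Rabs c <= vnorm (vadd e (vscal c v)).
Proof.
  intros HE Hv.
  assert (Hd : exists delta, 0 < delta /\ forall e, E e -> delta <= vnorm (vsub e v)).
  { apply NNPP. intros Hno. apply Hv.
    assert (H : forall n, exists e, E e /\ vnorm (vsub e v) < / INR (S n)).
    { intros n. apply NNPP. intros Hn. apply Hno. exists (/ INR (S n)). split.
      - apply Rinv_0_lt_compat, lt_0_INR. lia.
      - intros e He. apply Rnot_lt_le. intros Hlt. apply Hn. exists e. auto. }
    pose (u := fun n => epsilon (inhabits vzero) (fun e => E e /\ vnorm (vsub e v) < / INR (S n))).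
    assert (Hu : forall n, E (u n) /\ vnorm (vsub (u n) v) < / INR (S n)).
    { intros n. apply (epsilon_spec (inhabits vzero) (fun e => E e /\ vnorm (vsub e v) < / INR (S n))), H. }
    apply (proj2 (proj2 (proj2 HE)) u); [apply Hu|].
    intros eps Heps. destruct (archimed_cor1 eps Heps) as [N [HN HN0]].
    exists N. intros n Hn. apply Rlt_trans with (/ INR (S n)); [apply Hu|].
    apply Rle_lt_trans with (/ INR N); [|exact HN].
    apply Rinv_le_contravar; [apply lt_0_INR; lia|apply le_INR; lia]. }
  destruct Hd as [delta [Hd He]]. exists delta. split; [exact Hd|]. intros e c Hec.
  destruct (Req_dec c 0) as [->|Hc].
  - rewrite Rabs_R0, Rmult_0_r. apply vnorm_ge0.
  - replace (vadd e (vscal c v)) with (vscal (- c) (vsub (vscal (- / c) e) v)) by vlinear.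
    rewrite vnorm_scal, Rabs_Ropp. specialize (He (vscal (- / c) e)).
    pose proof (Rabs_pos c).
    assert (delta <= vnorm (vsub (vscal (- / c) e) v)) by (apply He, HE, Hec). nra.
Qed.

(** By [closed_subspace_distance], the coefficients of [v] along a convergent sequence are Cauchy.
    Removing their limit times [v] leaves a limit of vectors of [E]. *)
Lemma add_line_closed {Y : Banach} (E : Y -> Prop) (v : Y) :
  closed_subspace E -> ~ E v -> closed_subspace (add_line E v).
Proof.
  intros HE Hv.
  destruct (closed_subspace_distance E v HE Hv) as [delta [Hdelta Hdist]].
  pose proof HE as [H0 [Ha [Hs Hcl]]]. split; [|split; [|split]].
  - exists vzero, 0. split; [exact H0|]. vlinear.
  - intros x y [e [c [He ->]]] [e' [c' [He' ->]]].
    exists (vadd e e'), (c + c'). split; [auto|]. vlinear.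
  - intros a x [e [c [He ->]]]. exists (vscal a e), (a * c). split; [auto|]. vlinear.
  - intros u l Hu Hl.
    pose (c := fun n => epsilon (inhabits 0) (fun c => E (vsub (u n) (vscal c v)))).
    assert (Hc : forall n, E (vsub (u n) (vscal (c n) v))).
    { intros n. apply (epsilon_spec (inhabits 0) (fun c => E (vsub (u n) (vscal c v)))).
      destruct (Hu n) as [e [a [He Heq]]]. exists a. rewrite Heq.
      replace (vsub (vadd e (vscal a v)) (vscal a v)) with e by vlinear. exact He. }
    assert (Hcd : forall m n, delta * Rabs (c m - c n) <= vnorm (vsub (u m) (u n))).
    { intros m n.
      replace (vsub (u m) (u n)) with
        (vadd (vsub (vsub (u m) (vscal (c m) v)) (vsub (u n) (vscal (c n) v)))
              (vscal (c m - c n) v)) by vlinear.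
      apply Hdist, closed_subspace_sub; auto. }
    destruct (R_complete c) as [a Hca].
    { intros eps Heps. destruct (Hl (delta * eps / 2)) as [N HN].
      - apply Rdiv_lt_0_compat; [apply Rmult_lt_0_compat; lra|lra].
      - exists N. intros m n Hm Hn. unfold Rdist.
        apply (Rmult_lt_reg_l delta); [exact Hdelta|].
        apply Rle_lt_trans with (vnorm (vsub (u m) (u n))); [apply Hcd|].
        pose proof (vnorm_sub_triangle (u m) l (u n)) as Ht.
        rewrite (vnorm_sub_sym l) in Ht.
        pose proof (HN m Hm). pose proof (HN n Hn). lra. }
    exists (vsub l (vscal a v)), a. split; [|vlinear].
    apply (Hcl (fun n => vsub (u n) (vscal (c n) v))); [exact Hc|].
    intros eps Heps. pose proof (vnorm_ge0 v) as Hv0.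
    destruct (Hl (eps / 2)) as [N HN]; [lra|].
    destruct (Hca (eps / 2 / (vnorm v + 1))) as [M HM].
    { apply Rdiv_lt_0_compat; lra. }
    exists (max N M). intros n Hn.
    replace (vsub (vsub (u n) (vscal (c n) v)) (vsub l (vscal a v)))
      with (vsub (vsub (u n) l) (vscal (c n - a) v)) by vlinear.
    pose proof (vnorm_sub_le (vsub (u n) l) (vscal (c n - a) v)) as Ht.
    rewrite vnorm_scal in Ht.
    specialize (HN n ltac:(lia)). specialize (HM n ltac:(lia)). unfold Rdist in HM.
    apply (Rmult_lt_compat_r (vnorm v + 1)) in HM; [|lra].
    replace (eps / 2 / (vnorm v + 1) * (vnorm v + 1)) with (eps / 2) in HM by (field; lra).
    pose proof (Rabs_pos (c n - a)). nra.
Qed.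

(** The bounded operator of finite rank given by the pairs (f, v) of [fs]: the sum of the vectors
    f(y) v. *)
Definition dual_comb {Y : Banach} (fs : list (dual Y * Y)) (y : Y) : Y :=
  lincomb (map (fun p => (proj1_sig (fst p) y, snd p)) fs).

Lemma dual_comb_cons {Y : Banach} (f : dual Y) (v : Y) fs (y : Y) :
  dual_comb ((f, v) :: fs) y = vadd (vscal (proj1_sig f y) v) (dual_comb fs y).
Proof. reflexivity. Qed.

Lemma dual_comb_add {Y : Banach} (fs : list (dual Y * Y)) (x y : Y) :
  dual_comb fs (vadd x y) = vadd (dual_comb fs x) (dual_comb fs y).
Proof.
  induction fs as [|[f v] fs IH]; [symmetry; apply vadd_0|].
  rewrite !dual_comb_cons, IH, dual_add. vlinear.
Qed.

Lemma dual_comb_scal {Y : Banach} (fs : list (dual Y * Y)) (a : R) (y : Y) :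
  dual_comb fs (vscal a y) = vscal a (dual_comb fs y).
Proof.
  induction fs as [|[f v] fs IH]; [symmetry; apply vscal_0_r|].
  rewrite !dual_comb_cons, IH, dual_scal. vlinear.
Qed.

Lemma dual_comb_bounded {Y : Banach} (fs : list (dual Y * Y)) :
  exists C, forall y, vnorm (dual_comb fs y) <= C * vnorm y.
Proof.
  induction fs as [|[f v] fs [C HC]].
  - exists 0. intros y. unfold dual_comb, lincomb. simpl. rewrite vnorm_zero. lra.
  - exists (dual_norm f * vnorm v + C). intros y. rewrite dual_comb_cons.
    pose proof (vnorm_triangle _ (vscal (proj1_sig f y) v) (dual_comb fs y)) as H.
    rewrite vnorm_scal in H. specialize (HC y).
    pose proof (dual_norm_bound f y). pose proof (vnorm_ge0 v). nra.
Qed.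

Lemma dual_comb_wnull {Y : Banach} U (fs : list (dual Y * Y)) (d : nat -> Y) :
  nonprincipal_ultrafilter U -> wlimit U d vzero ->
  forall eps, eps > 0 -> U (fun n => vnorm (dual_comb fs (d n)) < eps).
Proof.
  intros HU Hd. induction fs as [|[f v] fs IH]; intros eps Heps.
  - apply uf_all; [exact HU|]. intros n. unfold dual_comb, lincomb. simpl.
    rewrite vnorm_zero. exact Heps.
  - pose proof (vnorm_ge0 v) as Hv.
    apply (uf_mono U HU (fun n => Rabs (proj1_sig f (d n)) < eps / 2 / (vnorm v + 1) /\
                                  vnorm (dual_comb fs (d n)) < eps / 2)).
    + intros n [H1 H2]. rewrite dual_comb_cons.
      pose proof (vnorm_triangle _ (vscal (proj1_sig f (d n)) v) (dual_comb fs (d n))) as H.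
      rewrite vnorm_scal in H.
      apply (Rmult_lt_compat_r (vnorm v + 1)) in H1; [|lra].
      replace (eps / 2 / (vnorm v + 1) * (vnorm v + 1)) with (eps / 2) in H1 by (field; lra).
      pose proof (Rabs_pos (proj1_sig f (d n))). nra.
    + apply uf_and; [exact HU| |apply IH; lra].
      specialize (Hd f). rewrite dual_zero in Hd.
      apply (uf_mono U HU (fun n => Rabs (proj1_sig f (d n) - 0) < eps / 2 / (vnorm v + 1))).
      * intros n. rewrite Rminus_0_r. auto.
      * apply Hd. apply Rdiv_lt_0_compat; lra.
Qed.

Lemma lincomb_cons_split {Y : Banach} (v : Y) (vs : list Y) (c : list (R * Y)) :
  (forall p, In p c -> In (snd p) (v :: vs)) ->
  exists a c', (forall p, In p c' -> In (snd p) vs) /\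
    lincomb c = vadd (vscal a v) (lincomb c').
Proof.
  induction c as [|[r w] c IH]; intros H.
  - exists 0, nil. split; [intros p []|]. simpl. vlinear.
  - destruct IH as [a [c' [Hc' Heq]]].
    { intros p Hp. apply H. right. exact Hp. }
    simpl. fold (lincomb c). rewrite Heq.
    destruct (H (r, w) (or_introl eq_refl)) as [Hw|Hw]; simpl in Hw.
    + subst w. exists (r + a), c'. split; [exact Hc'|]. vlinear.
    + exists a, ((r, w) :: c'). split.
      * intros p [<-|Hp]; [exact Hw|apply Hc', Hp].
      * simpl. fold (lincomb c'). vlinear.
Qed.

(** Modulo [E], the identity agrees with a bounded operator of finite rank. The induction on the
    spanning vectors keeps [E] general because it replaces [E] by E + Rv. *)
Lemma finite_codim_coordinates {Y : Banach} (vs : list Y) : forall E : Y -> Prop,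
  closed_subspace E ->
  (forall y, exists e c, E e /\ (forall p, In p c -> In (snd p) vs) /\ y = vadd e (lincomb c)) ->
  exists fs, forall y, E (vsub y (dual_comb fs y)).
Proof.
  induction vs as [|v vs IH]; intros E HE Hspan.
  - exists nil. intros y. destruct (Hspan y) as [e [[|p c] [He [Hc ->]]]].
    + unfold dual_comb. simpl.
      replace (vsub (vadd e vzero) vzero) with e by vlinear. exact He.
    + destruct (Hc p (or_introl eq_refl)).
  - destruct (classic (E v)) as [Hv|Hv].
    + apply IH; [exact HE|]. intros y. destruct (Hspan y) as [e [c [He [Hc ->]]]].
      destruct (lincomb_cons_split v vs c Hc) as [a [c' [Hc' ->]]].
      exists (vadd e (vscal a v)), c'. split; [|split; [exact Hc'|vlinear]].
      apply HE; [exact He|]. apply HE, Hv.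
    + destruct (IH (add_line E v)) as [fs Hfs].
      { apply add_line_closed; assumption. }
      { intros y. destruct (Hspan y) as [e [c [He [Hc ->]]]].
        destruct (lincomb_cons_split v vs c Hc) as [a [c' [Hc' ->]]].
        exists (vadd e (vscal a v)), c'. split; [|split; [exact Hc'|vlinear]].
        exists e, a. auto. }
      destruct (closed_subspace_distance E v HE Hv) as [delta [Hdelta Hdist]].
      (* [g y] is the coefficient of [v] in the part of [y] left over by [fs]. Uniqueness of this
         coefficient makes [g] linear, and the distance estimate makes it bounded. *)
      pose (g := fun y => epsilon (inhabits 0)
                   (fun c => E (vsub (vsub y (dual_comb fs y)) (vscal c v)))).
      assert (Hg : forall y, E (vsub (vsub y (dual_comb fs y)) (vscal (g y) v))).
      { intros y. apply (epsilon_spec (inhabits 0)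
                   (fun c => E (vsub (vsub y (dual_comb fs y)) (vscal c v)))).
        destruct (Hfs y) as [e [c [He Heq]]]. exists c. rewrite Heq.
        replace (vsub (vadd e (vscal c v)) (vscal c v)) with e by vlinear. exact He. }
      assert (Huniq : forall y c, E (vsub (vsub y (dual_comb fs y)) (vscal c v)) -> g y = c).
      { intros y c Hc.
        pose proof (Hdist _ (c - g y) (closed_subspace_sub E _ _ HE Hc (Hg y))) as H.
        match type of H with _ <= vnorm ?w => replace w with (@vzero Y) in H by vlinear end.
        rewrite vnorm_zero in H. pose proof (Rabs_pos (c - g y)).
        apply Rminus_diag_uniq_sym. destruct (Req_dec (c - g y) 0) as [Hz|Hz]; [exact Hz|].
        apply Rabs_pos_lt in Hz. nra. }
      assert (Hlin : bounded_linear_functional g).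
      { split; [|split].
        - intros x y. apply Huniq. rewrite dual_comb_add.
          match goal with |- E ?w => replace w with
            (vadd (vsub (vsub x (dual_comb fs x)) (vscal (g x) v))
                  (vsub (vsub y (dual_comb fs y)) (vscal (g y) v))) by vlinear end.
          apply HE; apply Hg.
        - intros a x. apply Huniq. rewrite dual_comb_scal.
          match goal with |- E ?w => replace w with
            (vscal a (vsub (vsub x (dual_comb fs x)) (vscal (g x) v))) by vlinear end.
          apply HE, Hg.
        - destruct (dual_comb_bounded fs) as [C HC]. exists (/ delta * (1 + C)). intros x.
          pose proof (Hdist _ (g x) (Hg x)) as H.
          match type of H with _ <= vnorm ?w =>
            replace w with (vsub x (dual_comb fs x)) in H by vlinear end.
          pose proof (vnorm_sub_le x (dual_comb fs x)). specialize (HC x).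
          apply (Rmult_le_reg_l delta); [exact Hdelta|].
          rewrite Rmult_assoc, <- Rmult_assoc, Rinv_r, Rmult_1_l by lra. lra. }
      pose (G := exist _ g Hlin : dual Y).
      exists ((G, v) :: fs). intros y. rewrite dual_comb_cons. simpl.
      replace (vsub y (vadd (vscal (g y) v) (dual_comb fs y)))
        with (vsub (vsub y (dual_comb fs y)) (vscal (g y) v)) by vlinear.
      apply Hg.
Qed.

(** The finite-rank operator complementary to [E] turns weak convergence to zero into norm
    convergence, so subtracting its values moves [d n] into [E] at small cost. *)
Lemma wnull_near_finite_codim {Y : Banach} U (E : Y -> Prop) (d : nat -> Y) (eps : R) :
  nonprincipal_ultrafilter U -> closed_subspace E -> finite_codim E -> wlimit U d vzero ->
  eps > 0 -> U (fun n => exists e, E e /\ vnorm (vsub (d n) e) < eps).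
Proof.
  intros HU HE [vs Hvs] Hd Heps.
  destruct (finite_codim_coordinates vs E HE Hvs) as [fs Hfs].
  apply (uf_mono U HU (fun n => vnorm (dual_comb fs (d n)) < eps)).
  - intros n Hn. exists (vsub (d n) (dual_comb fs (d n))). split; [apply Hfs|].
    replace (vsub (d n) (vsub (d n) (dual_comb fs (d n)))) with (dual_comb fs (d n)) by vlinear.
    exact Hn.
  - apply dual_comb_wnull; assumption.
Qed.

(** * Asymptotic uniform smoothness *)

(** Used to see that the innermost supremum in [mod_AUS] is over a nonempty set. *)
Lemma finite_codim_unit_vector {Y : Banach} (E : Y -> Prop) :
  closed_subspace E -> finite_codim E -> exists h, E h /\ vnorm h = 1.
Proof.
  intros HE [vs Hvs]. destruct (vinfinite_dim Y vs) as [x Hx].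
  destruct (Hvs x) as [e [c [He [Hc Heq]]]].
  assert (Hne : e <> vzero).
  { intros ->. apply (Hx c Hc). rewrite Heq. apply vadd_0. }
  apply vnorm_pos in Hne. exists (vscal (/ vnorm e) e).
  split; [apply HE, He|apply vnorm_unit, Hne].
Qed.

Lemma whole_space_closed (Y : Banach) : closed_subspace (fun _ : Y => True).
Proof. repeat split. Qed.

Lemma whole_space_finite_codim (Y : Banach) : finite_codim (fun _ : Y => True).
Proof.
  exists nil. intros y. exists y, nil. split; [exact I|]. split; [intros p []|].
  symmetry. apply vadd_0_r.
Qed.

Lemma vnorm_perturb {Y : Banach} (x h : Y) (t : R) : 0 < t -> vnorm x = 1 -> vnorm h = 1 ->
  - t <= vnorm (vadd x (vscal t h)) - 1 <= t.
Proof.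
  intros Ht Hx Hh.
  pose proof (vnorm_triangle _ x (vscal t h)) as H1.
  pose proof (vnorm_sub_le (vadd x (vscal t h)) (vscal t h)) as H2.
  replace (vsub (vadd x (vscal t h)) (vscal t h)) with x in H2 by vlinear.
  rewrite vnorm_scal, Rabs_pos_eq, Hh in H1, H2 by lra. lra.
Qed.

(** Unfolds the nested supremum, infimum and supremum of [mod_AUS] at one fixed scale [t], which
    serves all unit vectors [x]. *)
Lemma AUS_subspace (Y : Banach) (eps : R) : AUS Y -> eps > 0 ->
  exists t, 0 < t /\ forall x : Y, vnorm x = 1 ->
    exists E, closed_subspace E /\ finite_codim E /\
      forall h, E h -> vnorm h = 1 -> vnorm (vadd x (vscal t h)) <= 1 + eps * t.
Proof.
  intros HY Heps. destruct (HY eps Heps) as [delta [Hdelta Hmod]].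
  exists (delta / 2). split; [lra|]. set (t := delta / 2). assert (Ht : 0 < t) by (unfold t; lra).
  specialize (Hmod t ltac:(unfold t; lra)).
  assert (Hmod' : mod_AUS Y t < eps * t).
  { apply Rle_lt_trans with (mod_AUS Y t / t * t); [right; field; lra|].
    apply Rmult_lt_compat_r; [exact Ht|].
    apply Rle_lt_trans with (Rabs (mod_AUS Y t / t)); [apply Rle_abs|exact Hmod]. }
  (* [growth] and [growths] name the two inner sets of [mod_AUS]. By [vnorm_perturb] all values lie
     between [- t] and [t], which provides the bounds required for suprema and infima. *)
  pose (growth := fun (x : Y) (E : Y -> Prop) u =>
    exists h : Y, E h /\ vnorm h = 1 /\ u = vnorm (vadd x (vscal t h)) - 1).
  pose (growths := fun (x : Y) s => exists E : Y -> Prop,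
    closed_subspace E /\ finite_codim E /\ s = Rsup (growth x E)).
  assert (Hlub : forall x E, vnorm x = 1 -> closed_subspace E -> finite_codim E ->
            is_lub (growth x E) (Rsup (growth x E)) /\ - t <= Rsup (growth x E) <= t).
  { intros x E Hx HE HEc. destruct (finite_codim_unit_vector E HE HEc) as [h0 [Hh0 Hh0n]].
    assert (Hl : is_lub (growth x E) (Rsup (growth x E))).
    { apply Rsup_lub with t.
      - exists (vnorm (vadd x (vscal t h0)) - 1), h0. auto.
      - intros u [h [_ [Hh ->]]]. apply (vnorm_perturb x h t); assumption. }
    split; [exact Hl|]. destruct Hl as [Hub Hleast]. split.
    - apply Rle_trans with (vnorm (vadd x (vscal t h0)) - 1).
      + apply (vnorm_perturb x h0 t); assumption.
      + apply Hub. exists h0. auto.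
    - apply Hleast. intros u [h [_ [Hh ->]]]. apply (vnorm_perturb x h t); assumption. }
  assert (Hlow : forall x, vnorm x = 1 -> forall s, growths x s -> - t <= s).
  { intros x Hx s [E [HE [HEc ->]]]. apply Hlub; assumption. }
  assert (Hfull : forall x, growths x (Rsup (growth x (fun _ => True)))).
  { intros x. exists (fun _ => True). split; [apply whole_space_closed|].
    split; [apply whole_space_finite_codim|reflexivity]. }
  intros x Hx.
  assert (Hinf : Rinf (growths x) <= mod_AUS Y t).
  { apply (Rsup_lub (fun r => exists x, vnorm x = 1 /\ r = Rinf (growths x)) t).
    - exists (Rinf (growths x)), x. auto.
    - intros r [z [Hz ->]].
      apply Rle_trans with (Rsup (growth z (fun _ => True))).
      + apply Rinf_le with (- t); [apply Hlow, Hz|apply Hfull].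
      + apply Hlub; [exact Hz|apply whole_space_closed|apply whole_space_finite_codim].
    - exists x. auto. }
  destruct (Rinf_lt_witness (growths x) (- t) (eps * t)) as [s [[E [HE [HEc ->]]] Hs]].
  - exists (Rsup (growth x (fun _ => True))). apply Hfull.
  - apply Hlow, Hx.
  - lra.
  - exists E. split; [exact HE|]. split; [exact HEc|]. intros h Hh Hhn.
    assert (vnorm (vadd x (vscal t h)) - 1 <= Rsup (growth x E)).
    { apply Hlub; [exact Hx|exact HE|exact HEc|]. exists h. auto. }
    lra.
Qed.

(** Rescaled smoothness: a perturbation of bounded size is relatively small against a long vector.
    The radius 2 leaves room for approximants of vectors of norm at most 1. *)
Lemma AUS_large_vector (Y : Banach) (eps : R) : AUS Y -> eps > 0 ->
  exists T, 0 < T /\ forall x : Y, T <= vnorm x ->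
    exists E, closed_subspace E /\ finite_codim E /\
      forall h, E h -> vnorm h <= 2 -> vnorm (vadd x h) <= vnorm x + 2 * eps.
Proof.
  intros HY Heps. destruct (AUS_subspace Y eps HY Heps) as [t [Ht HE]].
  (* The threshold ensures [vnorm h / t <= vnorm x] whenever [vnorm h <= 2], so that both
     coefficients in the convexity argument are nonnegative. *)
  exists (2 / t). split; [apply Rdiv_lt_0_compat; lra|]. intros x Hx.
  assert (Hxt : 2 <= t * vnorm x).
  { apply (Rmult_le_compat_l t) in Hx; [|lra].
    replace (t * (2 / t)) with 2 in Hx by (field; lra). exact Hx. }
  assert (Hx0 : 0 < vnorm x).
  { pose proof (vnorm_ge0 x). destruct (Req_dec (vnorm x) 0); nra. }
  destruct (HE (vscal (/ vnorm x) x) (vnorm_unit x Hx0)) as [E [HEs [HEc Hsmooth]]].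
  exists E. split; [exact HEs|]. split; [exact HEc|]. intros h Hh Hh2.
  destruct (classic (h = vzero)) as [->|Hne].
  { rewrite vadd_0_r. lra. }
  apply vnorm_pos in Hne.
  specialize (Hsmooth (vscal (/ vnorm h) h) (proj1 (proj2 (proj2 HEs)) _ _ Hh) (vnorm_unit h Hne)).
  set (u := vscal (/ vnorm x) x) in *. set (k := vscal (/ vnorm h) h) in *.
  (* convexity of the norm along the segment from [u] to [u + t k] *)
  replace (vadd x h) with (vadd (vscal (vnorm x - vnorm h / t) u)
                                (vscal (vnorm h / t) (vadd u (vscal t k)))).
  2: { unfold u, k. vlinear. }
  pose proof (vnorm_triangle _ (vscal (vnorm x - vnorm h / t) u)
                (vscal (vnorm h / t) (vadd u (vscal t k)))) as H.
  assert (Hq : 0 < vnorm h / t) by (apply Rdiv_lt_0_compat; lra).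
  assert (Hq' : vnorm h / t <= vnorm x).
  { apply (Rmult_le_reg_r t); [exact Ht|].
    replace (vnorm h / t * t) with (vnorm h) by (field; lra). lra. }
  rewrite !vnorm_scal, !Rabs_pos_eq in H by lra.
  assert (Hu : vnorm u = 1) by (apply vnorm_unit, Hx0). rewrite Hu in H.
  apply (Rmult_le_compat_l (vnorm h / t)) in Hsmooth; [|lra].
  replace (vnorm h / t * (1 + eps * t)) with (vnorm h / t + eps * vnorm h) in Hsmooth by (field; lra).
  nra.
Qed.

(** * Concentration of Lipschitz maps on Hamming graphs *)

(** If [x] is long, smoothness costs [2 * eps] and moving [d n] into the subspace costs another
    [eps]. If [x] is shorter than [T], the triangle inequality suffices since [T + 1 <= s]. *)
Lemma AUS_wnull_step {Y : Banach} (eps : R) : AUS Y -> eps > 0 ->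
  exists T, 0 < T /\ forall U (x : Y) (d : nat -> Y) (s : R),
    nonprincipal_ultrafilter U -> wlimit U d vzero -> (forall n, vnorm (d n) <= 1) ->
    vnorm x <= s -> T + 1 <= s -> U (fun n => vnorm (vadd x (d n)) <= s + 3 * eps).
Proof.
  intros HY Heps. destruct (AUS_large_vector Y eps HY Heps) as [T [HT HE]].
  exists T. split; [exact HT|]. intros U x d s HU Hd Hd1 Hxs HTs.
  destruct (Rle_lt_dec T (vnorm x)) as [Hx|Hx].
  - destruct (HE x Hx) as [E [HEs [HEc Hadd]]].
    assert (Hmin : Rmin 1 eps > 0) by (apply Rmin_pos; lra).
    apply (uf_mono U HU (fun n => exists e, E e /\ vnorm (vsub (d n) e) < Rmin 1 eps)).
    + intros n [e [He Hde]].
      pose proof (Rmin_l 1 eps). pose proof (Rmin_r 1 eps).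
      assert (He2 : vnorm e <= 2).
      { replace e with (vsub (d n) (vsub (d n) e)) by vlinear.
        pose proof (vnorm_sub_le (d n) (vsub (d n) e)). specialize (Hd1 n). lra. }
      specialize (Hadd e He He2).
      replace (vadd x (d n)) with (vadd (vadd x e) (vsub (d n) e)) by vlinear.
      pose proof (vnorm_triangle _ (vadd x e) (vsub (d n) e)). lra.
    + apply wnull_near_finite_codim; assumption.
  - apply uf_all; [exact HU|]. intros n.
    pose proof (vnorm_triangle _ x (d n)). specialize (Hd1 n). lra.
Qed.

(** Imposed on lists of every length, so that fixing the first entry preserves the property. *)
Definition hamming_lipschitz {Y : Banach} (F : list nat -> Y) : Prop :=
  forall l l' n m, vnorm (vsub (F (l ++ n :: l')) (F (l ++ m :: l'))) <= 1.

Lemma hamming_lipschitz_cons {Y : Banach} (F : list nat -> Y) (n : nat) :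
  hamming_lipschitz F -> hamming_lipschitz (fun l => F (n :: l)).
Proof. intros HF l l' a b. apply (HF (n :: l)). Qed.

(* The iterated weak limit of [F (n_1 :: ... :: n_k :: nil)], the innermost
   limit being taken in [n_k]. *)
Fixpoint iter_wlim {Y : Banach} (U : (nat -> Prop) -> Prop) (k : nat) (F : list nat -> Y) : Y :=
  match k with
  | O => F nil
  | S k' => epsilon (inhabits vzero)
              (wlimit U (fun n => iter_wlim U k' (fun l => F (n :: l))))
  end.

(** The hypothesis bounds the inner limits, so a weak limit exists and the [epsilon] in [iter_wlim]
    selects a genuine one. *)
Lemma iter_wlim_spec {Y : Banach} U (k : nat) (F : list nat -> Y) (C : R) :
  nonprincipal_ultrafilter U -> reflexive Y ->
  (forall n, vnorm (vsub (iter_wlim U k (fun l => F (n :: l)))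
                         (iter_wlim U k (fun l => F (O :: l)))) <= C) ->
  wlimit U (fun n => iter_wlim U k (fun l => F (n :: l))) (iter_wlim U (S k) F).
Proof.
  intros HU HY HC. simpl. apply epsilon_spec.
  set (y0 := iter_wlim U k (fun l => F (O :: l))) in *.
  apply wlimit_exists with (C + vnorm y0); [exact HU|exact HY|]. intros n. specialize (HC n).
  set (yn := iter_wlim U k (fun l => F (n :: l))) in *.
  replace yn with (vadd (vsub yn y0) y0) by vlinear.
  pose proof (vnorm_triangle _ (vsub yn y0) y0). lra.
Qed.

Lemma iter_wlim_dist {Y : Banach} U (k : nat) : nonprincipal_ultrafilter U -> reflexive Y ->
  forall (F G : list nat -> Y) (C : R), hamming_lipschitz F -> hamming_lipschitz G ->
    (forall l, vnorm (vsub (F l) (G l)) <= C) ->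
    vnorm (vsub (iter_wlim U k F) (iter_wlim U k G)) <= C.
Proof.
  intros HU HY. induction k as [|k IH]; intros F G C HF HG HC; [apply HC|].
  assert (Hlim : forall H : list nat -> Y, hamming_lipschitz H ->
    wlimit U (fun n => iter_wlim U k (fun l => H (n :: l))) (iter_wlim U (S k) H)).
  { intros H HH. apply iter_wlim_spec with 1; [exact HU|exact HY|]. intros n.
    apply IH; try (apply hamming_lipschitz_cons, HH). intros l. apply (HH nil). }
  apply (wlimit_dist U _ _ _ _ C HU (Hlim F HF) (Hlim G HG)).
  intros n. apply IH; try (apply hamming_lipschitz_cons; assumption). intros l. apply HC.
Qed.

Lemma iter_wlim_cons_dist {Y : Banach} U (k : nat) (F : list nat -> Y) (n m : nat) :
  nonprincipal_ultrafilter U -> reflexive Y -> hamming_lipschitz F ->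
  vnorm (vsub (iter_wlim U k (fun l => F (n :: l))) (iter_wlim U k (fun l => F (m :: l)))) <= 1.
Proof.
  intros HU HY HF. apply iter_wlim_dist; try assumption; try (apply hamming_lipschitz_cons, HF).
  intros l. apply (HF nil).
Qed.

(** The iterated quantifier over lists of length [k]; the first entry is outermost, as in
    [iter_wlim]. *)
Fixpoint almost_all (U : (nat -> Prop) -> Prop) (k : nat) (P : list nat -> Prop) : Prop :=
  match k with
  | O => P nil
  | S k' => U (fun n => almost_all U k' (fun l => P (n :: l)))
  end.

(** Induction on [k]: releasing the first variable adds a weakly null increment, and
    [AUS_wnull_step] raises the bound from [s] to [s + 3 * eps]. The reference point [z] stays fixed
    while the iterated limit changes. *)
Lemma hamming_concentration_aux {Y : Banach} (eps : R) : reflexive Y -> AUS Y -> eps > 0 ->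
  exists T, 0 < T /\ forall U (k : nat) (F : list nat -> Y) (z : Y) (s : R),
    nonprincipal_ultrafilter U -> hamming_lipschitz F ->
    vnorm (vsub (iter_wlim U k F) z) <= s -> T + 1 <= s ->
    almost_all U k (fun l => vnorm (vsub (F l) z) <= s + 3 * eps * INR k).
Proof.
  intros HY HA Heps. destruct (AUS_wnull_step eps HA Heps) as [T [HT Hstep]].
  exists T. split; [exact HT|]. intros U k.
  induction k as [|k IH]; intros F z s HU HF Hs HTs.
  - simpl in *. lra.
  - cbn [almost_all].
    pose (d := fun n => vsub (iter_wlim U k (fun l => F (n :: l))) (iter_wlim U (S k) F)).
    assert (Hlim : wlimit U (fun n => iter_wlim U k (fun l => F (n :: l))) (iter_wlim U (S k) F)).
    { apply iter_wlim_spec with 1; [exact HU|exact HY|]. intros n.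
      apply iter_wlim_cons_dist; assumption. }
    assert (Hd0 : wlimit U d vzero).
    { replace (@vzero Y) with (vsub (iter_wlim U (S k) F) (iter_wlim U (S k) F)) by vlinear.
      apply wlimit_sub; [exact HU|exact Hlim|apply wlimit_const, HU]. }
    assert (Hd1 : forall n, vnorm (d n) <= 1).
    { intros n.
      (* All inner limits lie within 1 of the one at [n], hence so does their weak limit. *)
      apply (wlimit_dist U _ _ _ _ 1 HU (wlimit_const U _ HU) Hlim).
      intros m. apply iter_wlim_cons_dist; assumption. }
    apply (uf_mono U HU _ _) with
      (2 := Hstep U (vsub (iter_wlim U (S k) F) z) d s HU Hd0 Hd1 Hs HTs).
    intros n Hn. unfold d in Hn.
    replace (vadd (vsub (iter_wlim U (S k) F) z)
               (vsub (iter_wlim U k (fun l => F (n :: l))) (iter_wlim U (S k) F)))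
      with (vsub (iter_wlim U k (fun l => F (n :: l))) z) in Hn by vlinear.
    rewrite S_INR. replace (s + 3 * eps * (INR k + 1)) with (s + 3 * eps + 3 * eps * INR k) by ring.
    apply (IH (fun l => F (n :: l))); [exact HU|apply hamming_lipschitz_cons, HF|exact Hn|lra].
Qed.

Lemma hamming_concentration {Y : Banach} (eps : R) : reflexive Y -> AUS Y -> eps > 0 ->
  exists k, (0 < k)%nat /\ forall U (F : list nat -> Y),
    nonprincipal_ultrafilter U -> hamming_lipschitz F ->
    exists z, almost_all U k (fun l => vnorm (vsub (F l) z) <= 4 * eps * INR k).
Proof.
  intros HY HA Heps. destruct (hamming_concentration_aux eps HY HA Heps) as [T [HT Hconc]].
  (* [k] is so large that the starting bound [T + 1] is absorbed in [eps * INR k]; it depends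
     neither on [U] nor on [F]. *)
  destruct (INR_unbounded ((T + 1) / eps)) as [k Hk].
  assert (HTk : T + 1 <= eps * INR k).
  { apply (Rmult_lt_compat_l eps) in Hk; [|lra].
    replace (eps * ((T + 1) / eps)) with (T + 1) in Hk by (field; lra). lra. }
  exists k. split.
  - apply INR_lt. simpl. apply Rmult_lt_reg_l with eps; lra.
  - intros U F HU HF. exists (iter_wlim U k F).
    replace (4 * eps * INR k) with (eps * INR k + 3 * eps * INR k) by ring.
    apply Hconc; [exact HU|exact HF| |exact HTk].
    replace (vsub (iter_wlim U k F) (iter_wlim U k F)) with (@vzero Y) by vlinear.
    rewrite vnorm_zero. lra.
Qed.

(** * Blocks of a bounded sequence *)

Fixpoint lsum {X : Banach} (x : nat -> X) (l : list nat) : X :=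
  match l with
  | nil => vzero
  | n :: l' => vadd (x n) (lsum x l')
  end.

Lemma lsum_app {X : Banach} (x : nat -> X) (l l' : list nat) :
  lsum x (l ++ l') = vadd (lsum x l) (lsum x l').
Proof.
  induction l as [|n l IH]; simpl; [symmetry; apply vadd_0|].
  rewrite IH. apply vadd_assoc.
Qed.

(* Applying the concentration result to [f] after dilation by a large factor
   [lam] makes the additive constants of the coarse embedding negligible. *)
Lemma block_concentration {X Y : Banach} (f : X -> Y) (x : nat -> X) (M eta : R) :
  reflexive Y -> AUS Y -> coarse_lipschitz_embedding f -> (forall n, vnorm (x n) <= M) ->
  eta > 0 -> exists k, (0 < k)%nat /\ forall U, nonprincipal_ultrafilter U ->
    exists P, almost_all U k P /\ forall l l', P l -> P l' ->
      vnorm (vsub (lsum x l) (lsum x l')) <= eta * INR k.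
Proof.
  intros HY HA [L [HL [Hup Hlow]]] Hx Heta.
  assert (HM : 0 <= M) by (apply Rle_trans with (vnorm (x O)); [apply vnorm_ge0|apply Hx]).
  assert (Hpos : 0 < 8 * L * L * (2 * M + 1) + 1) by nra.
  (* The final estimate is [8 * L * L * (2 * M + 1)] times [eps * INR k], from twice the
     concentration radius and the two Lipschitz bounds, plus one more [eps * INR k] for the additive
     constant. *)
  set (eps := eta / (8 * L * L * (2 * M + 1) + 1)).
  assert (Heps : eps > 0) by (apply Rdiv_lt_0_compat; lra).
  destruct (@hamming_concentration Y eps HY HA Heps) as [k [Hk Hconc]].
  exists k. split; [exact Hk|]. intros U HU.
  assert (Hk0 : 0 < INR k) by (apply lt_0_INR, Hk).
  assert (Hek : 0 < eps * INR k) by (apply Rmult_lt_0_compat; lra).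
  (* Makes the additive error [L * L / lam] at most [eps * INR k]; the added 1 ensures
     [1 <= lam]. *)
  set (lam := L * L / (eps * INR k) + 1).
  assert (Hlam1 : 1 <= lam).
  { unfold lam. assert (0 < L * L / (eps * INR k)); [|lra].
    apply Rdiv_lt_0_compat; [nra|exact Hek]. }
  assert (Hlam : L * L <= lam * (eps * INR k)).
  { unfold lam. rewrite Rmult_plus_distr_r.
    replace (L * L / (eps * INR k) * (eps * INR k)) with (L * L) by (field; split; lra). lra. }
  (* Changing one entry moves the dilated sum by at most [2 * M * lam], hence its image by at most
     [L * (2 * M * lam) + L], which is at most [Lam] as [1 <= lam]. *)
  set (Lam := L * lam * (2 * M + 1)).
  assert (HLam : 0 < Lam).
  { unfold Lam. apply Rmult_lt_0_compat; [apply Rmult_lt_0_compat; lra|lra]. }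
  pose (F := fun l => vscal (/ Lam) (f (vscal lam (lsum x l)))).
  assert (HFF : forall l l', vnorm (vsub (F l) (F l')) =
            / Lam * vnorm (vsub (f (vscal lam (lsum x l))) (f (vscal lam (lsum x l'))))).
  { intros l l'. unfold F.
    rewrite <- (Rabs_pos_eq (/ Lam)) at 3 by (apply Rlt_le, Rinv_0_lt_compat, HLam).
    rewrite <- vnorm_scal. f_equal. vlinear. }
  assert (HF : hamming_lipschitz F).
  { intros l l' n m. rewrite HFF. apply (Rmult_le_reg_l Lam); [exact HLam|].
    rewrite <- Rmult_assoc, Rinv_r, Rmult_1_l, Rmult_1_r by lra.
    apply Rle_trans with (L * (lam * (2 * M)) + L).
    - apply Hup; [nra|]. rewrite !lsum_app. simpl.
      match goal with |- vnorm ?w <= _ => replace w with (vscal lam (vsub (x n) (x m))) by vlinear end.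
      rewrite vnorm_scal, Rabs_pos_eq by lra. apply Rmult_le_compat_l; [lra|].
      pose proof (vnorm_sub_le (x n) (x m)). pose proof (Hx n). pose proof (Hx m). lra.
    - unfold Lam. nra. }
  destruct (Hconc U F HU HF) as [z Hz].
  exists (fun l => vnorm (vsub (F l) z) <= 4 * eps * INR k). split; [exact Hz|].
  intros l l' Hl Hl'.
  assert (Hd : vnorm (vsub (F l) (F l')) <= 8 * (eps * INR k)).
  { pose proof (vnorm_sub_triangle (F l) z (F l')) as H. rewrite (vnorm_sub_sym z) in H. lra. }
  rewrite HFF in Hd.
  apply (Rmult_le_compat_l Lam) in Hd; [|lra].
  rewrite <- Rmult_assoc, Rinv_r, Rmult_1_l in Hd by lra.
  set (D := vnorm (vsub (lsum x l) (lsum x l'))).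
  assert (HD : lam * D / L - L <= Lam * (8 * (eps * INR k))).
  { apply Rle_trans with (2 := Hd). apply Rge_le, Hlow.
    - apply Rle_ge, Rmult_le_pos; [lra|apply vnorm_ge0].
    - right. unfold D. rewrite <- (Rabs_pos_eq lam) at 3 by lra.
      rewrite <- vnorm_scal. f_equal. vlinear. }
  apply (Rmult_le_compat_l L) in HD; [|lra].
  replace (L * (lam * D / L - L)) with (lam * D - L * L) in HD by (field; lra).
  assert (Heq : eta * INR k = (8 * L * L * (2 * M + 1) + 1) * (eps * INR k)).
  { unfold eps. field. lra. }
  rewrite Heq. apply (Rmult_le_reg_l lam); [lra|].
  unfold Lam in HD. nra.
Qed.

(** * Diagonal extraction of a subsequence *)

Lemma almost_all_ext U (k : nat) (P Q : list nat -> Prop) :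
  (forall l, P l = Q l) -> almost_all U k P -> almost_all U k Q.
Proof.
  intros H HP. replace Q with P; [exact HP|]. apply functional_extensionality, H.
Qed.

(** Greedy construction: almost every entry keeps [Q] true and almost every entry exceeds the last
    one, so an entry with both properties exists. *)
Lemma ultrafilter_branch U (Q : list nat -> Prop) : nonprincipal_ultrafilter U ->
  Q nil -> (forall s, Q s -> U (fun n => Q (s ++ n :: nil))) ->
  exists phi : nat -> nat, (forall j, (phi j < phi (S j))%nat) /\
    forall r, Q (map phi (seq 0 r)).
Proof.
  intros HU Q0 QS.
  pose (next := fun s => epsilon (inhabits O) (fun n => (last s O < n)%nat /\ Q (s ++ n :: nil))).
  assert (Hnext : forall s, Q s -> (last s O < next s)%nat /\ Q (s ++ next s :: nil)).
  { intros s Hs.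
    apply (epsilon_spec (inhabits O) (fun n => (last s O < n)%nat /\ Q (s ++ n :: nil))).
    apply (uf_witness U); [exact HU|]. apply uf_and; [exact HU|apply uf_gt, HU|apply QS, Hs]. }
  pose (hist := fix hist (r : nat) : list nat :=
    match r with O => nil | S r' => hist r' ++ next (hist r') :: nil end).
  assert (HQ : forall r, Q (hist r)).
  { induction r as [|r IH]; [exact Q0|]. apply Hnext, IH. }
  exists (fun r => next (hist r)). split.
  - intros j. pose proof (proj1 (Hnext (hist (S j)) (HQ (S j)))) as H.
    simpl hist in H at 1. rewrite last_last in H. exact H.
  - intros r. replace (map (fun r => next (hist r)) (seq 0 r)) with (hist r); [apply HQ|].
    induction r as [|r IH]; [reflexivity|].
    rewrite seq_S, map_app. simpl. rewrite <- IH. reflexivity.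
Qed.

(** Condition [i] is imposed only on blocks that start at a position [a >= i], so each new entry has
    to respect only finitely many conditions. *)
Lemma diagonal_blocks U (k : nat -> nat) (P : nat -> list nat -> Prop) :
  nonprincipal_ultrafilter U -> (forall i, almost_all U (k i) (P i)) ->
  exists phi : nat -> nat, (forall j, (phi j < phi (S j))%nat) /\
    forall i a, (i <= a)%nat -> P i (map phi (seq a (k i))).
Proof.
  intros HU HP.
  (* every block under construction can almost surely be completed *)
  pose (Q := fun s : list nat => forall a, (a < S (length s))%nat -> forall i, (i < S a)%nat ->
    (length s - a <= k i)%nat ->
    almost_all U (k i - (length s - a)) (fun l => P i (skipn a s ++ l))).
  destruct (ultrafilter_branch U Q HU) as [phi [Hphi HQ]].
  - intros a Ha i Hi _. simpl in *. rewrite Nat.sub_0_r.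
    apply almost_all_ext with (P i); [|apply HP]. intros l. rewrite skipn_nil. reflexivity.
  - intros s Hs.
    assert (Hold : U (fun n => forall a, (a < S (length s))%nat -> forall i, (i < S a)%nat ->
      (length s - a < k i)%nat ->
      almost_all U (k i - S (length s - a)) (fun l => P i (skipn a s ++ n :: l)))).
    { apply (uf_forall_below U (fun a n => forall i, (i < S a)%nat -> (length s - a < k i)%nat ->
        almost_all U (k i - S (length s - a)) (fun l => P i (skipn a s ++ n :: l)))); [exact HU|].
      intros a Ha.
      apply (uf_forall_below U (fun i n => (length s - a < k i)%nat ->
        almost_all U (k i - S (length s - a)) (fun l => P i (skipn a s ++ n :: l)))); [exact HU|].
      intros i Hi. apply uf_impl; [exact HU|]. intros Hlt.
      specialize (Hs a Ha i Hi ltac:(lia)).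
      replace (k i - (length s - a))%nat with (S (k i - S (length s - a))) in Hs by lia.
      exact Hs. }
    apply (uf_mono U HU _ _) with (2 := Hold). intros n Hn a Ha i Hi Hle.
    rewrite length_app in *. simpl length in *.
    (* A block starting just after the new entry is still empty, and the hypothesis on [P i] covers
       it; the other blocks are extended by [n]. *)
    destruct (Nat.eq_dec a (length s + 1)) as [->|Hne].
    + replace (k i - (length s + 1 - (length s + 1)))%nat with (k i) by lia.
      apply almost_all_ext with (P i); [|apply HP]. intros l.
      rewrite skipn_all2; [reflexivity|]. rewrite length_app. simpl. lia.
    + replace (k i - (length s + 1 - a))%nat with (k i - S (length s - a))%nat by lia.
      apply almost_all_ext with (fun l => P i (skipn a s ++ n :: l)).
      * intros l. rewrite skipn_app. replace (a - length s)%nat with O by lia.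
        simpl. rewrite <- app_assoc. reflexivity.
      * apply Hn; lia.
  - exists phi. split; [exact Hphi|]. intros i a Hia.
    (* After [a + k i] entries the block starting at [a] is complete, and no quantifier remains. *)
    specialize (HQ (a + k i)%nat a). rewrite length_map, length_seq in HQ.
    specialize (HQ ltac:(lia) i ltac:(lia) ltac:(lia)).
    replace (k i - (a + k i - a))%nat with O in HQ by lia. simpl in HQ.
    rewrite app_nil_r, seq_app, map_app, skipn_app, skipn_all2, length_map, length_seq, Nat.sub_diag
      in HQ by (rewrite length_map, length_seq; lia).
    exact HQ.
Qed.

(** * Cesaro means *)

Lemma vsum_block {X : Banach} (x : nat -> X) (phi : nat -> nat) (a k : nat) :
  vsum (fun j => x (phi j)) (a + k) =
  vadd (vsum (fun j => x (phi j)) a) (lsum x (map phi (seq a k))).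
Proof.
  induction k as [|k IH].
  - rewrite Nat.add_0_r. simpl. symmetry. apply vadd_0_r.
  - rewrite Nat.add_succ_r, seq_S, map_app, lsum_app. simpl. rewrite IH. vlinear.
Qed.

Lemma vsum_affine_bound {X : Banach} (y : nat -> X) (c : X) (M : R) (n : nat) :
  (forall j, vnorm (y j) <= M) ->
  vnorm (vsub (vsum y n) (vscal (INR n) c)) <= INR n * (M + vnorm c).
Proof.
  intros Hy. induction n as [|n IH].
  - simpl. replace (vsub vzero (vscal 0 c)) with (@vzero X) by vlinear. rewrite vnorm_zero. lra.
  - rewrite S_INR. simpl vsum.
    replace (vsub (vadd (vsum y n) (y n)) (vscal (INR n + 1) c))
      with (vadd (vsub (vsum y n) (vscal (INR n) c)) (vsub (y n) c)) by vlinear.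
    pose proof (vnorm_triangle _ (vsub (vsum y n) (vscal (INR n) c)) (vsub (y n) c)).
    pose proof (vnorm_sub_le (y n) c). specialize (Hy n). lra.
Qed.

(** With [c] the mean of one reference block, removing a final block of length [k] changes the
    partial sum minus [n] times [c] by at most [eta * INR k]. Strong induction reduces to short
    sums, bounded by the constant [K]. *)
Lemma cesaro_near_block_mean {X : Banach} (x : nat -> X) (phi : nat -> nat) (M eta : R) (i k : nat) :
  (forall n, vnorm (x n) <= M) -> eta > 0 -> (0 < k)%nat ->
  (forall a, (i <= a)%nat ->
     vnorm (vsub (lsum x (map phi (seq a k))) (lsum x (map phi (seq i k)))) <= eta * INR k) ->
  exists c N, forall n, (n >= N)%nat ->
    vnorm (vsub (vscal (/ INR (S n)) (vsum (fun j => x (phi j)) (S n))) c) <= 2 * eta.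
Proof.
  intros Hx Heta Hk Hblock.
  assert (Hk0 : 0 < INR k) by (apply lt_0_INR, Hk).
  set (y := fun j => x (phi j)). set (B := lsum x (map phi (seq i k))).
  set (c := vscal (/ INR k) B). set (K := INR (i + k) * (M + vnorm c)).
  assert (HM : 0 <= M) by (apply Rle_trans with (vnorm (x O)); [apply vnorm_ge0|apply Hx]).
  assert (Hbound : forall n, vnorm (vsub (vsum y n) (vscal (INR n) c)) <= K + eta * INR n).
  { intros n. induction n as [n IH] using (well_founded_induction Nat.lt_wf_0).
    pose proof (pos_INR n). pose proof (vnorm_ge0 c).
    destruct (Nat.lt_ge_cases n (i + k)) as [Hn|Hn].
    - apply Rle_trans with (INR n * (M + vnorm c)).
      + apply vsum_affine_bound. intros j. apply Hx.
      + assert (INR n <= INR (i + k)) by (apply le_INR; lia). unfold K. nra.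
    - set (m := (n - k)%nat). replace n with (m + k)%nat in * by (unfold m; lia).
      specialize (IH m ltac:(lia)). specialize (Hblock m ltac:(lia)). fold B in Hblock.
      unfold y in *. rewrite vsum_block, plus_INR.
      replace (vsub (vadd (vsum (fun j => x (phi j)) m) (lsum x (map phi (seq m k))))
                    (vscal (INR m + INR k) c))
        with (vadd (vsub (vsum (fun j => x (phi j)) m) (vscal (INR m) c))
                   (vsub (lsum x (map phi (seq m k))) B)) by (unfold c; vlinear).
      match goal with |- vnorm (vadd ?u ?v) <= _ => pose proof (vnorm_triangle _ u v) end.
      lra. }
  (* Beyond [N], the constant [K] contributes at most a second [eta] to the mean. *)
  destruct (INR_unbounded (K / eta)) as [N HN]. exists c, N. intros n Hn.
  assert (Hn0 : 0 < INR (S n)) by (apply lt_0_INR; lia).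
  assert (HKn : K <= eta * INR (S n)).
  { apply (Rmult_lt_compat_l eta) in HN; [|lra].
    replace (eta * (K / eta)) with K in HN by (field; lra).
    assert (INR N <= INR (S n)) by (apply le_INR; lia). nra. }
  replace (vsub (vscal (/ INR (S n)) (vsum y (S n))) c)
    with (vscal (/ INR (S n)) (vsub (vsum y (S n)) (vscal (INR (S n)) c))) by vlinear.
  rewrite vnorm_scal, Rabs_pos_eq by (apply Rlt_le, Rinv_0_lt_compat, Hn0).
  apply (Rmult_le_reg_l (INR (S n))); [exact Hn0|].
  rewrite <- Rmult_assoc, Rinv_r, Rmult_1_l by lra.
  specialize (Hbound (S n)). lra.
Qed.

Theorem theorem1p1 (X Y : Banach) :
  reflexive Y -> AUS Y -> coarse_lipschitz_embeds X Y -> banach_saks X.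
Proof.
  intros HY HA [f Hf] x [M HM].
  destruct nonprincipal_ultrafilter_exists as [U HU].
  assert (Heta : forall i, / INR (S i) > 0).
  { intros i. apply Rinv_0_lt_compat, lt_0_INR. lia. }
  assert (Hblocks : forall i, exists kP : nat * (list nat -> Prop), (0 < fst kP)%nat /\
    almost_all U (fst kP) (snd kP) /\ forall l l', snd kP l -> snd kP l' ->
      vnorm (vsub (lsum x l) (lsum x l')) <= / INR (S i) * INR (fst kP)).
  { intros i.
    destruct (block_concentration f x M _ HY HA Hf HM (Heta i)) as [k [Hk HP]].
    destruct (HP U HU) as [P HP']. exists (k, P). auto. }
  pose (kP := fun i => proj1_sig (constructive_indefinite_description _ (Hblocks i))).
  pose proof (fun i => proj2_sig (constructive_indefinite_description _ (Hblocks i))) as HkP.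
  destruct (diagonal_blocks U (fun i => fst (kP i)) (fun i => snd (kP i)) HU) as [phi [Hphi HP]].
  { intros i. apply HkP. }
  exists phi. split; [exact Hphi|].
  (* Completeness supplies the limit, so it suffices that the means are Cauchy. *)
  apply vcomplete. intros eps Heps.
  (* Two late means each lie within [2 * / INR (S i)] of [c], hence within four times [/ INR (S i)]
     of each other. *)
  destruct (archimed_cor1 (eps / 4)) as [i [Hi Hi0]]; [lra|].
  assert (Hi' : / INR (S i) < eps / 4).
  { apply Rle_lt_trans with (/ INR i); [|exact Hi].
    apply Rinv_le_contravar; [apply lt_0_INR; lia|apply le_INR; lia]. }
  destruct (HkP i) as [Hk [_ Hclose]].
  destruct (cesaro_near_block_mean x phi M (/ INR (S i)) i (fst (kP i)) HM (Heta i) Hk)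
    as [c [N HN]].
  { intros a Ha. apply Hclose; apply HP; lia. }
  exists N. intros m n Hm Hn.
  match goal with |- vnorm (vadd ?u (vopp ?v)) < _ =>
    pose proof (vnorm_sub_triangle u c v) as Ht end.
  rewrite (vnorm_sub_sym c) in Ht.
  pose proof (HN m Hm). pose proof (HN n Hn). unfold vsub at 1 in Ht. lra.
Qed.
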